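(* Let $q\in(0,2]$, $a_k=k^{\alpha}$ and $\sigma_k=\exp(\beta k)$, $k\in\mathbb N$, with $\alpha>0$, $\beta>0$. All limits are as $\varepsilon\to0$. (a) Let $u_\varepsilon=u_\varepsilon(r_\varepsilon)$ be given by $u_\varepsilon^2=\frac{1}{2\varepsilon^4}\inf_{\eta\in\Theta_2(r_\varepsilon)}\sum_k\eta_k^4$, let $\{\tilde\eta_k\}$ be the extreme sequence of this problem, $w_k=\tilde\eta_k^2/\sqrt{2\sum_j\tilde\eta_j^4}$, $t_\varepsilon=\sum_kw_k\big((y_k/\varepsilon)^2-1\big)$ and $\psi_{\varepsilon,H}=\mathbf 1_{\{t_\varepsilon>H\}}$. If $u_\varepsilon\to\infty$, then for any $c\in(0,1)$ the family $\psi_{\varepsilon,H}$ with $H=H_\varepsilon\sim c\,u_\varepsilon$ is asymptotically minimax consistent, that is, $\gamma_\varepsilon(\Theta_q(r_\varepsilon),\psi_{\varepsilon,H_\varepsilon})\to0$. (b) The separation rates (for the alternatives $\Theta_q(r_\varepsilon)$) are of the form $$r_\varepsilon^*=\big(\log(\varepsilon^{-1})/\beta\big)^{-\alpha}.$$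
   Context: Model: one observes $y=\{y_k\}_{k\in\mathbb N}$, $y_k=\eta_k+\varepsilon\xi_k$, with $\xi_k$ i.i.d. $N(0,1)$, $\varepsilon>0$ small, $\eta\in\ell^2$ unknown; $E_{\varepsilon,\eta}$ is the corresponding expectation. Sets: for $q\in(0,2]$, $\Theta_q=\{\eta\in\ell^2:\sum_k|a_k\sigma_k\eta_k|^q\le1\}$, $\Theta_q(r)=\{\eta\in\Theta_q:\sum_k\sigma_k^2\eta_k^2\ge r^2\}$. $r_\varepsilon>0$ is a family with $r_\varepsilon\to0$ as $\varepsilon\to0$. One tests $H_0:\eta=0$ against $H_1:\eta\in\Theta_q(r_\varepsilon)$. Tests and errors: a (randomized) test $\psi$ is a measurable function of $y$ with values in $[0,1]$. $\alpha_\varepsilon(\psi)=E_{\varepsilon,0}\psi$, $\beta_\varepsilon(\Theta,\psi)=\sup_{\eta\in\Theta}E_{\varepsilon,\eta}(1-\psi)$, $\gamma_\varepsilon(\Theta,\psi)=\alpha_\varepsilon(\psi)+\beta_\varepsilon(\Theta,\psi)$. $\beta_\varepsilon(r,\vartheta)=\inf_{\psi:\alpha_\varepsilon(\psi)\le\vartheta}\beta_\varepsilon(\Theta_q(r),\psi)$ for a level $\vartheta\in(0,1)$, and $\gamma_\varepsilon(r)=\inf_\psi\gamma_\varepsilon(\Theta_q(r),\psi)$. Separation rate: a positive family $r_\varepsilon^*\to0$ such that $\gamma_\varepsilon(r_\varepsilon)\to1$ and $\beta_\varepsilon(r_\varepsilon,\vartheta)\to1-\vartheta$ for any $\vartheta\in(0,1)$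 as $r_\varepsilon/r_\varepsilon^*\to0$, while $\gamma_\varepsilon(r_\varepsilon)\to0$ and $\beta_\varepsilon(r_\varepsilon,\vartheta)\to0$ for any $\vartheta\in(0,1)$ as $r_\varepsilon/r_\varepsilon^*\to\infty$. The (nonnegative) extreme sequence, for $r_\varepsilon$ small, is $\tilde\eta_k^2=z_0^2\sigma_k^2(1-Aa_k^2)_+$, where $(x)_+=\max\{0,x\}$ and $z_0=z_{0,\varepsilon}$, $A=A_\varepsilon$ are determined by $\sum_k\sigma_k^2\tilde\eta_k^2=r_\varepsilon^2$ and $\sum_ka_k^2\sigma_k^2\tilde\eta_k^2=1$. $A_\varepsilon\sim B_\varepsilon$ means the ratio tends to $1$. *)

(* Defs.v *)
From HB Require Import structures.
From mathcomp Require Import all_boot all_order all_algebra finmap.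
From mathcomp Require Import all_classical all_reals all_analysis.

Set Implicit Arguments.
Unset Strict Implicit.
Unset Printing Implicit Defensive.

Import Order.TTheory GRing.Theory Num.Theory.
Import numFieldNormedType.Exports.

Local Open Scope classical_set_scope.
Local Open Scope ring_scope.

(* Sequences are indexed by nat from 0: position k holds the term of index
   k + 1, so that the index set is {1, 2, ...}. *)

Definition pow_seq (R : realType) (alpha : R) (k : nat) : R :=
  k.+1%:R `^ alpha.

Definition exp_seq (R : realType) (beta : R) (k : nat) : R :=
  expR (beta * k.+1%:R).

Section noise.
Context d (T : measurableType d) (R : realType) (P : probability T R).

Definition mutually_independent (X : nat -> {RV P >-> R}) : Prop :=
  forall (J : {fset nat}) (B : nat -> set R), (forall i, measurable (B i)) ->
    P (\bigcap_(i in [set` J]) (X i @^-1` B i)) =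
    (\big[*%E/1%E]_(i <- J) P (X i @^-1` B i))%E.

Definition iid_std_normal (xi : nat -> {RV P >-> R}) : Prop :=
  (forall k (B : set R), measurable B ->
     distribution P (xi k) B = normal_prob 0 1 B) /\
  mutually_independent xi.

End noise.

Section alternatives.
Context (R : realType).
Variables a s : nat -> R.

Definition l2 : set (nat -> R) :=
  [set eta | (\sum_(k <oo) ((eta k) ^+ 2)%:E < +oo)%E].

Definition Theta (q : R) : set (nat -> R) :=
  [set eta | l2 eta /\ (\sum_(k <oo) (`|a k * s k * eta k| `^ q)%:E <= 1)%E].

Definition Theta_r (q r : R) : set (nat -> R) :=
  [set eta | Theta q eta /\
     ((r ^+ 2)%:E <= \sum_(k <oo) ((s k) ^+ 2 * (eta k) ^+ 2)%:E)%E].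

(* The infimum is +oo if Theta_r 2 r is empty and is finite otherwise; u is
   only considered for small r. *)
Definition u_val (eps r : R) : R :=
  Num.sqrt ((2 * eps ^+ 4)^-1 *
    fine (ereal_inf [set (\sum_(k <oo) ((eta k) ^+ 4)%:E)%E
                    | eta in Theta_r 2 r])).

(* The two constraints are read in the extended reals, so they force both
   series to converge (hence 0 < A when a_k tends to infinity). *)
Definition extreme_sequence (r : R) (eta : nat -> R) : Prop :=
  exists z0 A : R,
    [/\ forall k, 0 <= eta k,
        forall k, (eta k) ^+ 2 =
          z0 ^+ 2 * (s k) ^+ 2 * Num.max 0 (1 - A * (a k) ^+ 2),
        (\sum_(k <oo) ((s k) ^+ 2 * (eta k) ^+ 2)%:E)%E = (r ^+ 2)%:E &
        (\sum_(k <oo) ((a k) ^+ 2 * (s k) ^+ 2 * (eta k) ^+ 2)%:E)%E = 1%E].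

End alternatives.

Section tests.
Context (R : realType).

(* generators of the product sigma-algebra on R^N *)
Definition cylinders : set (set (nat -> R)) :=
  \bigcup_k preimage_set_system [set: nat -> R] (fun y => y k) measurable.

Definition is_test (psi : (nat -> R) -> R) : Prop :=
  measurable_fun [set: g_sigma_algebraType cylinders]
    (psi : g_sigma_algebraType cylinders -> R) /\
  (forall y, 0 <= psi y <= 1).

Definition weights (eta : nat -> R) (k : nat) : R :=
  (eta k) ^+ 2 / Num.sqrt (2 * limn (series (fun j => (eta j) ^+ 4))).

Definition t_stat (eta : nat -> R) (eps : R) (y : nat -> R) : R :=
  limn (series (fun k => weights eta k * ((y k / eps) ^+ 2 - 1))).

Definition psi_test (eta : nat -> R) (eps H : R) (y : nat -> R) : R :=
  if H < t_stat eta eps y then 1 else 0.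

End tests.

Section errors.
Context d (T : measurableType d) (R : realType) (P : probability T R).
Variable xi : nat -> {RV P >-> R}.

Definition observation (eps : R) (eta : nat -> R) (w : T) : nat -> R :=
  fun k => eta k + eps * xi k w.

Definition E_obs (eps : R) (eta : nat -> R) (f : (nat -> R) -> R) : R :=
  fine 'E_P[fun w => f (observation eps eta w)].

Definition alpha_err (eps : R) (psi : (nat -> R) -> R) : R :=
  E_obs eps (fun=> 0) psi.

(* By convention the real sup of an empty set of alternatives is 0; Theta_r is
   nonempty for small r. *)
Definition beta_err (eps : R) (Th : set (nat -> R)) (psi : (nat -> R) -> R) : R :=
  sup [set E_obs eps eta (fun y => 1 - psi y) | eta in Th].

Definition gamma_err (eps : R) (Th : set (nat -> R)) (psi : (nat -> R) -> R) : R :=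
  alpha_err eps psi + beta_err eps Th psi.

Definition minimax_beta (eps : R) (Th : set (nat -> R)) (theta : R) : R :=
  inf [set beta_err eps Th psi
      | psi in [set psi | is_test psi /\ alpha_err eps psi <= theta]].

Definition minimax_gamma (eps : R) (Th : set (nat -> R)) : R :=
  inf [set gamma_err eps Th psi | psi in @is_test R].

Definition vanishing_family (r : R -> R) : Prop :=
  (\forall e \near 0^'+, 0 < r e) /\ (r e @[e --> 0^'+] --> (0 : R)).

Definition separation_rate (Th : R -> set (nat -> R)) (rstar : R -> R) : Prop :=
  vanishing_family rstar /\
  forall r : R -> R, vanishing_family r ->
    (((r e / rstar e : R) @[e --> 0^'+] --> (0 : R)) ->
       (minimax_gamma e (Th (r e)) @[e --> 0^'+] --> (1 : R)) /\
       (forall theta : R, 0 < theta < 1 ->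
          minimax_beta e (Th (r e)) theta @[e --> 0^'+] --> (1 - theta : R))) /\
    (((r e / rstar e : R) @[e --> 0^'+] --> +oo) ->
       (minimax_gamma e (Th (r e)) @[e --> 0^'+] --> (0 : R)) /\
       (forall theta : R, 0 < theta < 1 ->
          minimax_beta e (Th (r e)) theta @[e --> 0^'+] --> (0 : R))).

End errors.

(* Main.v *)
Require Import Defs.
From HB Require Import structures.
From mathcomp Require Import all_boot all_order all_algebra finmap.
From mathcomp Require Import all_classical all_reals all_analysis.
From mathcomp Require Import measurable_realfun ring lra.

(** Upper bounds use Chebyshev and Markov only.  For the extreme sequence [et],
    the statistic has variance at most [C] under the null hypothesis, and for a
    signal [eta] its mean [h] and variance satisfy [h >= u] and
    [variance <= 8 h + C]; the bound [h >= u] is the Lagrangian optimality of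
    [et], so no asymptotics of [u] is needed.  For the separation rate, with
    [K = log (1/e) / beta] so that [exp (beta K) = 1/e], the plain energy of the
    first [K/2] coordinates already separates the hypotheses when [r / r*] is
    large: the ellipsoid leaves at least [r^2 / 2] of the weighted energy there,
    and the noise amplification is at most [e^{-1/2}].

    Conversely, when [r / r*] is small, a signal carried by the single coordinate
    [j ~ 2 K], with [a_j s_j eta_j = 1], lies in the alternative for every [q],
    while [eta_j / e <= e]; the law of one Gaussian coordinate shifted by [t]
    differs from the unshifted one by at most [2 t] in expectation of functions
    with values in [[0, 1]]. *)

Set Implicit Arguments.
Unset Strict Implicit.
Unset Printing Implicit Defensive.

Import Order.TTheory GRing.Theory Num.Theory.
Import numFieldNormedType.Exports.

Local Open Scope classical_set_scope.
Local Open Scope ring_scope.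

(** * Gaussian shifts and moments *)

(** The indices [K/2] and [2K] work because of a mismatch of scales. Since [a] is polynomial, moving
    the frequency by a constant factor changes the rate only by a constant; since [s] is
    exponential, the same move changes [exp (beta k)] by a power of [1/e], which beats every power
    of [K]. Each side of [K] therefore leaves room for crude constants and an unweighted energy. The
    exponent [q] is handled by inclusion: [Theta q] lies in [Theta 2], so upper bounds are proved
    for [q = 2], while a one-coordinate signal can saturate the constraint for all [q] at once.

    Independence is given only for finitely many coordinate events, but both the vanishing of cross
    terms in the variance and the conditioning in the lower bound call for [xi k] to be independent
    of the whole remaining sequence. That joint law is obtained once, from a pi-system of
    finite-dimensional boxes, and Fubini then serves both purposes. *)

Section normal.
Context (R : realType).
Local Notation mu := (@lebesgue_measure R).
Local Notation N01 := (@normal_prob R 0 1).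

(** The change of variables holds for the Radon-Nikodym derivative, which agrees almost everywhere
    with [normal_pdf] because both integrate to the same value over every measurable set. *)
Lemma ge0_integral_normal_prob (m s : R) (f : R -> \bar R) :
  measurable_fun [set: R] f -> (forall x, 0 <= f x)%E ->
  (\int[normal_prob m s]_x f x =
   \int[mu]_x (f x * (normal_pdf m s x)%:E))%E.
Proof.
move=> mf f0.
have dom := normal_prob_dominates m s.
rewrite -(Radon_Nikodym_SigmaFinite.change_of_variables dom f0)//.
apply: ae_eq_integral => //.
- apply: emeasurable_funM => //.
  exact: measurable_int (Radon_Nikodym_SigmaFinite.f_integrable dom).
- apply: emeasurable_funM => //.
  by apply/measurable_EFinP; exact: measurable_normal_pdf.
- apply: ae_eqe_mul2l; apply: integral_ae_eq => //.
  + exact: Radon_Nikodym_SigmaFinite.f_integrable.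
  + by apply/measurable_EFinP; exact: measurable_normal_pdf.
  + by move=> A _ mA; rewrite -Radon_Nikodym_SigmaFinite.f_integral.
Qed.

Lemma lebesgue_measure_shift (c : R) (A : set R) : measurable A ->
  pushforward mu (fun x : R => (x + c : measurableTypeR R)) A = mu A.
Proof.
move=> mA.
have mc : measurable_fun [set: R] (fun x : R => (x + c : measurableTypeR R)).
  exact: measurable_funD.
pose h := mfun_Sub (mem_set mc : (fun x : R => (x + c : measurableTypeR R)) \in mfun).
apply/esym.
apply: (@lebesgue_measure_unique _ (pushforward mu h)) => //= _ [[a b]] _ <-.
rewrite /pushforward/=.
rewrite (_ : _ @^-1` _ = `]a - c, b - c]%classic); last first.
  by apply/seteqP; split => x /=; rewrite !in_itv/= ltrBlDr lerBrDr.
rewrite !lebesgue_measure_itv/= !lte_fin ltrD2r; case: ifP => // _.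
by rewrite -!EFinD; congr EFin; ring.
Qed.

Lemma ge0_integral_shift (c : R) (f : R -> \bar R) :
  measurable_fun [set: R] f -> (forall x, 0 <= f x)%E ->
  (\int[mu]_x f (x + c)%R = \int[mu]_x f x)%E.
Proof.
move=> mf f0.
have mc : measurable_fun [set: R] (fun x : R => (x + c : measurableTypeR R)).
  exact: measurable_funD.
transitivity (\int[pushforward mu (fun x : R => (x + c : measurableTypeR R)%R)]_x f x)%E.
  by rewrite ge0_integral_pushforward//.
by apply: eq_measure_integral => //= A mA _; exact: lebesgue_measure_shift.
Qed.

(* Likelihood ratio of N(t, 1) with respect to N(0, 1). *)
Definition lik (t x : R) : R := expR (t * x - t ^+ 2 / 2).

Lemma lik_pdf t x : lik t x * normal_pdf 0 1 x = normal_pdf t 1 x.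
Proof.
rewrite /lik /normal_pdf oner_eq0 mulrCA; congr (_ * _).
rewrite /normal_fun -expRD; congr expR.
by rewrite expr1n; field.
Qed.

Lemma measurable_lik t : measurable_fun [set: R] (lik t).
Proof.
apply: measurableT_comp => //; apply: measurable_funB => //.
Qed.

Lemma integral_lik t : (\int[N01]_x (lik t x)%:E = 1)%E.
Proof.
rewrite ge0_integral_normal_prob; last 2 first.
- apply/measurable_EFinP; exact: measurable_lik.
- by move=> x; rewrite lee_fin expR_ge0.
rewrite -(integral_normal_pdf t 1); apply: eq_integral => x _.
by rewrite -EFinM lik_pdf.
Qed.

(** Completing the square gives [lik t ^+ 2 = expR (t ^+ 2) * lik (2 * t)]. Together with
    [integral_lik] this is the chi-square distance [expR (t ^+ 2) - 1] between the shifted and the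
    unshifted law. *)
Lemma integral_lik_sqr t : (\int[N01]_x ((lik t x) ^+ 2)%R%:E = (expR (t ^+ 2))%:E)%E.
Proof.
transitivity (\int[N01]_x ((expR (t ^+ 2))%:E * (lik (2 * t) x)%:E))%E.
  apply: eq_integral => x _; rewrite -EFinM; congr EFin.
  rewrite /lik -expRM_natl -expRD; congr expR.
  by field.
rewrite ge0_integralZl ?integral_lik ?mule1//.
- apply/measurable_EFinP; exact: measurable_lik.
- by move=> x _; rewrite lee_fin expR_ge0.
Qed.

Lemma integral_normal_shift (t : R) (g : R -> R) :
  measurable_fun [set: R] g -> (forall x, 0 <= g x) ->
  (\int[N01]_x (g (x + t)%R)%:E = \int[N01]_x (g x * lik t x)%R%:E)%E.
Proof.
move=> mg g0.
have ms : measurable_fun [set: R] (fun x : R => x + t).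
  exact: measurable_funD.
rewrite !ge0_integral_normal_prob; last 4 first.
- apply/measurable_EFinP; apply: measurable_funM => //; exact: measurable_lik.
- by move=> x; rewrite lee_fin mulr_ge0// expR_ge0.
- apply/measurable_EFinP; exact: (measurableT_comp mg).
- by move=> x; rewrite lee_fin.
pose F x := ((g x)%:E * (normal_pdf t 1 x)%:E)%E.
transitivity (\int[mu]_x F (x + t)%R)%E; last first.
  rewrite ge0_integral_shift; last 2 first.
  - apply: emeasurable_funM; apply/measurable_EFinP => //.
    exact: measurable_normal_pdf.
  - by move=> x; rewrite mule_ge0 ?lee_fin ?normal_pdf_ge0.
  apply: eq_integral => x _.
  by rewrite /F -lik_pdf !EFinM muleA.
apply: eq_integral => x _; rewrite /F; congr (_ * _%:E)%E.
rewrite /normal_pdf oner_eq0; congr (_ * expR _).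
by rewrite subr0 addrK.
Qed.

(** With [L = lik t], the loss is the integral of [g (1 - L)], and the weighted AM-GM inequality
    bounds the integrand by [t/2 + (1 - L)^2 / (2t)]. The chi-square distance is at most [2 t^2],
    which leaves [t/2 + t]. *)
Lemma normal_shift_le (t : R) (g : R -> R) :
  measurable_fun [set: R] g -> (forall x, 0 <= g x <= 1) -> 0 < t <= 2^-1 ->
  (\int[N01]_x (g x)%:E <= \int[N01]_x (g (x + t)%R)%:E + (2 * t)%:E)%E.
Proof.
move=> mg g01 /andP[t0 t2].
have g0 x : 0 <= g x by have /andP[] := g01 x.
have ml := measurable_lik t.
have l0 x : 0 <= lik t x by rewrite expR_ge0.
have mgl : measurable_fun [set: R] (fun x => g x * lik t x).
  exact: measurable_funM.
have ml2 : measurable_fun [set: R] (fun x => (lik t x) ^+ 2).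
  exact: measurable_funX.
rewrite integral_normal_shift//.
(* The inequality is arranged with the negative part of [(1 - L)^2 / (2t)] moved to the left, so
   that both sides are integrals of nonnegative functions and no integrability has to be discussed
   yet. *)
have H : (\int[N01]_x (g x)%:E + (t^-1)%:E * 1 <=
  \int[N01]_x (g x * lik t x)%R%:E +
    ((t / 2 + t^-1 / 2)%:E + (t^-1 / 2)%:E * (expR (t ^+ 2))%:E))%E.
  rewrite -[1%E](integral_lik t) -(integral_lik_sqr t).
  rewrite -!ge0_integralZl//; try by [apply/measurable_EFinP|
    rewrite lee_fin ?divr_ge0// ?invr_ge0 ltW|
    move=> x _; rewrite lee_fin ?sqr_ge0].
  have -> : (t / 2 + t^-1 / 2)%:E = (\int[N01]_x (cst (t / 2 + t^-1 / 2)%:E) x)%E.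
    by rewrite integral_cst// [X in (_ * X)%E]probability_setT mule1.
  have ti0 : 0 <= t^-1 by rewrite invr_ge0 ltW.
  have t2i0 : 0 <= t / 2 by rewrite divr_ge0 ?ltW.
  have ti20 : 0 <= t^-1 / 2 by rewrite divr_ge0.
  rewrite -!ge0_integralD//; try by [
    move=> x _; rewrite /cst -?EFinM -?EFinD lee_fin ?addr_ge0//;
      try (by rewrite mulr_ge0// sqr_ge0); exact: addr_ge0 |
    repeat apply: emeasurable_funD => //; apply/measurable_EFinP => //;
    apply: measurable_funM].
  apply: ge0_le_integral => //.
  - by move=> x _; rewrite -EFinM -EFinD lee_fin addr_ge0// mulr_ge0.
  - by apply/measurable_EFinP; apply: measurable_funD => //; apply: measurable_funM.
  - apply/measurable_EFinP; apply: measurable_funD => //.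
    by apply: measurable_funD => //; apply: measurable_funM.
  move=> x _; rewrite /cst -!EFinM -!EFinD lee_fin.
  have /andP[_ g1] := g01 x.
  have tt : t * t^-1 = 1 by rewrite divff ?gt_eqF.
  move: (g x) (lik t x) (t^-1) (g0 x) g1 (l0 x) ti0 tt => G L u G0 G1 L0 u0 tu.
  (* This square, divided by two, is the AM-GM inequality; [u] stands for [t^-1]. *)
  have : 0 <= u * (t * G - (1 - L)) ^+ 2 by rewrite mulr_ge0// sqr_ge0.
  have -> : u * (t * G - (1 - L)) ^+ 2 =
     (t * u) * (t * G ^+ 2 - 2 * G * (1 - L)) + u * (1 - L) ^+ 2 by ring.
  rewrite tu mul1r.
  have G2 : G ^+ 2 <= 1 by nra.
  have : t * G ^+ 2 <= t by rewrite ler_piMr// ltW.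
  nra.
move: H; rewrite mule1.
have fin : (\int[N01]_x (g x * lik t x)%R%:E)%E \is a fin_num.
  rewrite ge0_fin_numE.
    apply: (@le_lt_trans _ _ (\int[N01]_x (lik t x)%:E)%E); last by rewrite integral_lik ltry.
    apply: ge0_le_integral => //.
    - by move=> x _; rewrite lee_fin mulr_ge0.
    - exact/measurable_EFinP.
    - exact/measurable_EFinP.
    - by move=> x _; rewrite lee_fin ler_piMl//; have /andP[] := g01 x.
  by apply: integral_ge0 => x _; rewrite lee_fin mulr_ge0.
have fin' : (\int[N01]_x (g x)%:E)%E \is a fin_num.
  rewrite ge0_fin_numE.
    apply: (@le_lt_trans _ _ (\int[N01]_x (cst 1%E) x)%E).
      apply: ge0_le_integral => //; first by move=> x _; rewrite lee_fin.
      - exact/measurable_EFinP.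
      - by move=> x _; rewrite lee_fin; have /andP[] := g01 x.
    by rewrite integral_cst// mul1e [X in (X < _)%E]probability_setT ltry.
  by apply: integral_ge0 => x _; rewrite lee_fin.
move: (\int[N01]_x (g x * lik t x)%R%:E)%E (\int[N01]_x (g x)%:E)%E fin fin'.
move=> [a| |]// [b| |]// _ _; rewrite -!EFinM -!EFinD !lee_fin => H.
(* For [x = t^2 <= 1/2], [exp (-x) >= 1 - x] gives [exp x <= 1 / (1 - x) <= 1 + 2x]. *)
have He : expR (t ^+ 2) <= 1 + 2 * t ^+ 2.
  have t21 : t ^+ 2 <= 2^-1 by nra.
  have h1 : 0 < 1 - t ^+ 2 by nra.
  have h2 := expR_ge1Dx (- t ^+ 2).
  have h3 : expR (t ^+ 2) * expR (- t ^+ 2) = 1.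
    by rewrite -expRD subrr expR0.
  rewrite -(ler_pM2r h1); have := expR_gt0 (t ^+ 2); nra.
have tt : t^-1 * t ^+ 2 = t by rewrite expr2 mulrA mulVf ?mul1r// gt_eqF.
have ti0 : 0 < t^-1 by rewrite invr_gt0.
have : t^-1 * expR (t ^+ 2) <= t^-1 * (1 + 2 * t ^+ 2) by rewrite ler_pM2l.
lra.
Qed.

End normal.

(** * Moments of the standard normal law *)

Section normal_moments.
Context (R : realType).
Local Notation mu := (@lebesgue_measure R).
Local Notation N01 := (@normal_prob R 0 1).

(** The fourth power is absorbed by a wider Gaussian of standard deviation 2. With [y = x^2 / 8] the
    densities are proportional to [exp (-4y)] and [exp (-y)], while [x^4 = 64 y^2] and
    [y^2 <= exp (2y) <= exp (3y)]; this is the origin of the 64 in [c]. *)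
Lemma integral_x4_normal_lty : (\int[N01]_x (x ^+ 4)%R%:E < +oo)%E.
Proof.
have mx4 : measurable_fun [set: R] (fun x : R => x ^+ 4) by exact: measurable_funX.
rewrite ge0_integral_normal_prob; last 2 first.
- exact/measurable_EFinP.
- by move=> x; rewrite lee_fin exprn_even_ge0.
pose c : R := 64 * (normal_peak 1 / normal_peak 2).
have p2 : 0 < normal_peak (2 : R) by rewrite normal_peak_gt0.
have p1 : 0 < normal_peak (1 : R) by rewrite normal_peak_gt0// oner_eq0.
have c0 : 0 <= c by rewrite mulr_ge0// divr_ge0 ?ltW.
apply: (@le_lt_trans _ _ (\int[mu]_x (c%:E * (normal_pdf 0 2 x)%:E))%E).
  apply: ge0_le_integral => //.
  - by move=> x _; rewrite mule_ge0// lee_fin ?exprn_even_ge0// normal_pdf_ge0.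
  - apply: emeasurable_funM; apply/measurable_EFinP => //.
    exact: measurable_normal_pdf.
  - apply: emeasurable_funM => //; apply/measurable_EFinP.
    exact: measurable_normal_pdf.
  move=> x _; rewrite -!EFinM lee_fin /normal_pdf oner_eq0 pnatr_eq0/= /c.
  have -> : 64 * (normal_peak 1 / normal_peak 2) *
      (normal_peak 2 * normal_fun 0 2 x) =
    normal_peak 1 * (64 * normal_fun 0 2 x).
    by field; rewrite gt_eqF.
  rewrite mulrCA ler_pM2l// /normal_fun subr0 expr1n.
  set y := x ^+ 2 / 8.
  have y0 : 0 <= y by rewrite divr_ge0// sqr_ge0.
  have -> : x ^+ 4 = 64 * (y * y) by rewrite /y; field.
  have -> : - x ^+ 2 / (1 *+ 2) = - (4 * y) by rewrite /y; field.
  have -> : - x ^+ 2 / (2 ^+ 2 *+ 2) = - y by rewrite /y; field.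
  clearbody y; have -> : 4 * y = y + y + y + y by ring.
  rewrite -mulrA ler_pM2l// !opprD !expRD !expRN.
  have ye : y <= expR y by have := expR_ge1Dx y; lra.
  have e1 : 1 <= expR y by have := expR_ge1Dx y; lra.
  have e0 := expR_gt0 y.
  rewrite !mulrA ler_piMl ?invr_ge0 ?expR_ge0//.
  rewrite -!mulrA -!invfM !mulrA ler_pdivrMr ?mul1r; last by rewrite !mulr_gt0.
  have : y * y <= expR y * expR y by rewrite ler_pM.
  move=> h; apply: (le_trans h); rewrite ler_peMr// ltW// mulr_gt0.
rewrite ge0_integralZl//.
- by rewrite integral_normal_pdf mule1 ltry.
- by apply/measurable_EFinP; exact: measurable_normal_pdf.
- by move=> x _; rewrite lee_fin normal_pdf_ge0.
Qed.

Lemma integrable_normal_growth4 (c : R) (f : R -> R) :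
  measurable_fun [set: R] f -> (forall x, `|f x| <= c * (1 + x ^+ 4)) ->
  N01.-integrable [set: R] (EFin \o f).
Proof.
move=> mf fc.
have mx4 : measurable_fun [set: R] (fun x : R => x ^+ 4) by exact: measurable_funX.
have i4 : N01.-integrable [set: R] (fun x : R => (x ^+ 4)%:E).
  apply/integrableP; split; first exact/measurable_EFinP.
  under eq_integral do rewrite gee0_abs ?lee_fin ?exprn_even_ge0//.
  exact: integral_x4_normal_lty.
have i1 : N01.-integrable [set: R] (cst 1%E).
  exact: finite_measure_integrable_cst.
have i14 := integrableZl measurableT c (integrableD measurableT i1 i4).
apply: le_integrable i14 => //; first exact/measurable_EFinP.
move=> x _; rewrite /= lee_fin (le_trans (fc x))//= ler_norm//.
Qed.

Lemma integrable_normal_id : N01.-integrable [set: R] (EFin \o id).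
Proof.
apply: (@integrable_normal_growth4 1) => // x; rewrite mul1r.
rewrite /= ler_norml.
have := sqr_ge0 (x ^+ 2 - 1); have := sqr_ge0 (x - 1); have := sqr_ge0 (x + 1).
have -> : x ^+ 4 = (x ^+ 2) * (x ^+ 2) by ring.
by move=> *; apply/andP; split; nra.
Qed.

Lemma integrable_normal_sqr : N01.-integrable [set: R] (fun x : R => (x ^+ 2)%:E).
Proof.
apply: (@integrable_normal_growth4 1 (fun x : R => x ^+ 2)) => [|x].
  exact: measurable_funX.
by rewrite mul1r ger0_norm ?sqr_ge0//; have := sqr_ge0 (x ^+ 2 - 1); nra.
Qed.

(* Both moments are read off tangent-line bounds [1 + a <= expR a] for
   integrands whose integral is known for every value of a parameter. *)
Lemma normal_mean : (\int[N01]_x x%:E = 0)%E.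
Proof.
have ii := integrable_normal_id.
have /fineK : (\int[N01]_x (x : R)%:E)%E \is a fin_num.
  exact: integrable_fin_num.
set m := fine _ => mE; rewrite -mE.
have key t : t * m <= t ^+ 2 / 2.
  have ic : N01.-integrable [set: R] (cst (1 - t ^+ 2 / 2)%:E).
    exact: finite_measure_integrable_cst.
  have iz := integrableZl measurableT t ii.
  have : (\int[N01]_x ((1 - t ^+ 2 / 2)%:E + t%:E * (x : R)%:E) <= 1)%E.
    rewrite -(integral_lik t); apply: le_integral => //.
    - exact: integrableD.
    - apply/integrableP; split; first by apply/measurable_EFinP; exact: measurable_lik.
      under eq_integral do rewrite gee0_abs ?lee_fin ?expR_ge0//.
      by rewrite integral_lik ltry.
    - move=> x _; rewrite -EFinM -EFinD lee_fin.
      by rewrite /lik; have := expR_ge1Dx (t * x - t ^+ 2 / 2); lra.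
  rewrite integralD//= integral_cst// integralZl// -mE.
  rewrite [X in (_ * X + _)%E]probability_setT mule1 -EFinM -EFinD lee_fin; lra.
(* At [t = m / 2] the bound [key] reads [m^2 / 2 <= m^2 / 8]. *)
congr EFin; have [m0|m0|//] := ltgtP m 0.
- by have := key (m / 2); nra.
- by have := key (m / 2); nra.
Qed.

Lemma normal_second_moment : (\int[N01]_x (x ^+ 2)%R%:E = 1)%E.
Proof.
have ii := integrable_normal_sqr.
have /fineK : (\int[N01]_x (x ^+ 2 : R)%:E)%E \is a fin_num.
  exact: integrable_fin_num.
set m := fine _ => mE; rewrite -mE.
have m0 : 0 <= m by rewrite fine_ge0// integral_ge0// => x _; rewrite lee_fin sqr_ge0.
have key s : 0 < s -> (s ^+ 2 - 1) * m <= 2 * s ^+ 2 * (s - 1).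
  move=> s0.
  (* The value for which [expR (c * x ^+ 2)] turns the density of N(0, 1) into [s] times the density
     with standard deviation [s], so that its integral is [s]. *)
  pose c := (1 - s ^- 2) / 2.
  pose G (x : R) := expR (c * x ^+ 2).
  have mG : measurable_fun [set: R] G.
    by apply: measurableT_comp => //; apply: measurable_funM => //; exact: measurable_funX.
  have iG : (\int[N01]_x (G x)%:E = s%:E)%E.
    rewrite ge0_integral_normal_prob; last 2 first.
    - exact/measurable_EFinP.
    - by move=> x; rewrite lee_fin expR_ge0.
    transitivity (\int[mu]_x (s%:E * (normal_pdf 0 s x)%:E))%E.
      apply: eq_integral => x _; rewrite -!EFinM; congr EFin.
      rewrite /normal_pdf oner_eq0 gt_eqF//.
      have -> : normal_peak s = normal_peak 1 / s.
        rewrite /normal_peak expr1n mul1r -mulrnAr sqrtrM ?sqr_ge0//.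
        by rewrite sqrtr_sqr gtr0_norm// invfM mulrC.
      have -> : s * (normal_peak 1 / s * normal_fun 0 s x) =
          normal_peak 1 * normal_fun 0 s x by field; rewrite gt_eqF.
      rewrite mulrCA; congr (_ * _).
      rewrite /G /normal_fun -expRD; congr expR.
      by rewrite /c subr0; field; rewrite gt_eqF.
    rewrite ge0_integralZl//.
    - by rewrite integral_normal_pdf mule1.
    - by apply/measurable_EFinP; exact: measurable_normal_pdf.
    - by move=> x _; rewrite lee_fin normal_pdf_ge0.
    - by rewrite lee_fin ltW.
  have ic : N01.-integrable [set: R] (cst 1%:E).
    exact: finite_measure_integrable_cst.
  have iz := integrableZl measurableT c ii.
  have : (\int[N01]_x (1%:E + c%:E * (x ^+ 2 : R)%:E) <= s%:E)%E.
    rewrite -iG; apply: le_integral => //.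
    - exact: integrableD.
    - apply/integrableP; split; first exact/measurable_EFinP.
      under eq_integral do rewrite gee0_abs ?lee_fin ?expR_ge0//.
      by rewrite iG ltry.
    - by move=> x _; rewrite -EFinM -EFinD lee_fin expR_ge1Dx.
  rewrite integralD//= integral_cst// integralZl// -mE.
  rewrite [X in (_ * X + _)%E]probability_setT mule1 -EFinM -EFinD lee_fin.
  move=> h; have s20 : 0 < 2 * s ^+ 2 by rewrite mulr_gt0// exprn_gt0.
  have -> : (s ^+ 2 - 1) * m = 2 * s ^+ 2 * (c * m).
    by rewrite /c; field; rewrite gt_eqF.
  by rewrite ler_pM2l//; lra.
(* Dividing [key] by [s - 1] gives [(s + 1) m <= 2 s^2] for [s > 1] and the reverse for [s < 1]; as
   [s] tends to 1 both force [m = 1]. A distance [h] of [s] from 1 equal to a quarter of the gap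
   already contradicts. *)
congr EFin; have [m1|m1|//] := ltgtP m 1.
- pose h := (1 - m) / 4.
  have h0 : 0 < h by rewrite divr_gt0// subr_gt0.
  have h1 : h <= 4^-1 by rewrite /h; lra.
  have := key (1 - h) ltac:(lra).
  have -> : m = 1 - 4 * h by rewrite /h; field.
  move=> k.
  have : h * ((2 - h) * (1 - 4 * h)) >= h * (2 * (1 - h) ^+ 2) by nra.
  by rewrite ler_pM2l//; nra.
- pose h := (m - 1) / 4.
  have h0 : 0 < h by rewrite divr_gt0// subr_gt0.
  have := key (1 + h) ltac:(lra).
  have -> : m = 1 + 4 * h by rewrite /h; field.
  move=> k.
  have : h * ((2 + h) * (1 + 4 * h)) <= h * (2 * (1 + h) ^+ 2) by nra.
  by rewrite ler_pM2l//; nra.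
Qed.

Lemma normal_fourth_moment_fin :
  exists C : R, 0 <= C /\ (\int[N01]_x ((x ^+ 2 - 1) ^+ 2)%R%:E <= C%:E)%E.
Proof.
have : N01.-integrable [set: R] (EFin \o (fun x : R => (x ^+ 2 - 1) ^+ 2)).
  apply: (@integrable_normal_growth4 2) => [|x].
    by apply: measurable_funX; apply: measurable_funB => //; exact: measurable_funX.
  by rewrite ger0_norm ?sqr_ge0//; have := sqr_ge0 (x ^+ 2 + 1); nra.
move=> /(integrable_fin_num measurableT)/fineK E.
eexists; split; last by rewrite -E.
by rewrite fine_ge0// integral_ge0// => x _; rewrite lee_fin sqr_ge0.
Qed.

End normal_moments.

(** * Independence of one coordinate from the others *)

Section sequence_space.
Context (R : realType).
Local Notation Y := (g_sigma_algebraType (@cylinders R)).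

Lemma measurable_coord (k : nat) :
  measurable_fun [set: Y] ((fun y => y k) : Y -> R).
Proof.
move=> _ B mB; apply: sub_sigma_algebra; exists k => //; exists B => //.
Qed.

Lemma measurable_fun_seq d (T : measurableType d) (f : T -> Y) :
  (forall k, measurable_fun [set: T] (fun w => f w k)) ->
  measurable_fun [set: T] f.
Proof.
move=> mf; apply: (@measurability _ _ T Y setT f (@cylinders R)) => //.
move=> _ [_ [k _ [B mB <-]] <-].
by rewrite !setTI; have := mf k measurableT B mB; rewrite setTI.
Qed.

(** The sets [cylinders] constrain one coordinate and are not closed under intersection. Boxes with
    finitely many nontrivial sides are, they generate the same sigma-algebra, and independence gives
    their probabilities as finite products. *)
Definition boxes : set (set (nat -> R)) :=
  [set S | exists n (B : nat -> set R),
    [/\ forall i, measurable (B i), forall i, (n <= i)%N -> B i = setT &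
        S = [set y | forall i, B i (y i)]]].

Lemma boxesI : setI_closed boxes.
Proof.
move=> _ _ [n [B [mB BT ->]]] [m [C [mC CT ->]]].
exists (maxn n m), (fun i => B i `&` C i); split.
- by move=> i; exact: measurableI.
- by move=> i; rewrite geq_max => /andP[ni mi]; rewrite BT// CT// setIT.
- apply/seteqP; split => y /=; first by move=> [By Cy] i; split.
  by move=> h; split => i; have [] := h i.
Qed.

Lemma boxes_measurable : boxes `<=` (@measurable _ Y).
Proof.
move=> _ [n [B [mB BT ->]]].
rewrite (_ : [set y | _] = \bigcap_i ((fun y : Y => y i) @^-1` B i)).
  apply: bigcap_measurable => // i _.
  by have := measurable_coord i measurableT (mB i); rewrite setTI.
apply/seteqP; split => y /=; first by move=> h i _; exact: h.
by move=> h i; exact: h.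
Qed.

Lemma sigma_boxes : (@measurable _ Y) = <<s boxes >>.
Proof.
apply/seteqP; split.
  apply: smallest_sub; first exact: smallest_sigma_algebra.
  move=> _ [k _ [B mB <-]]; apply: sub_sigma_algebra; rewrite setTI.
  exists k.+1, (fun i => if i == k then B else setT); split.
  - by move=> i; case: ifP.
  - by move=> i ki; rewrite gtn_eqF.
  - apply/seteqP; split => y /=; first by move=> h i; case: eqP => // ->.
    by move=> /(_ k); rewrite eqxx.
apply: smallest_sub; last exact: boxes_measurable.
exact: sigma_algebra_measurable.
Qed.

(** Overwriting coordinate [k], instead of deleting it, keeps the other coordinates at their indices
    and in the same sequence space. *)
Definition zero_at (k : nat) (y : nat -> R) : nat -> R :=
  fun i => if i == k then 0 else y i.

End sequence_space.

Section independence.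
Context d (T : measurableType d) (R : realType) (P : probability T R).
Variable xi : nat -> {RV P >-> R}.
Hypothesis hxi : iid_std_normal xi.
Local Notation N01 := (@normal_prob R 0 1).
Local Notation Y := (g_sigma_algebraType (@cylinders R)).

Lemma prob_box (n : nat) (B : nat -> set R) :
  (forall i, measurable (B i)) -> (forall i, (n <= i)%N -> B i = setT) ->
  P [set w | forall i, B i (xi i w)] = (\prod_(i < n) N01 (B i))%E.
Proof.
move=> mB BT; have [hd hind] := hxi.
have [J JE Jp] : exists2 J : {fset nat},
    forall i, (i \in J) = (i < n)%N & perm_eq J (iota 0 n).
  exists (seq_fset tt (iota 0 n)) => [i|]; first by rewrite seq_fsetE mem_iota.
  by rewrite (perm_trans (seq_fset_perm _ _))// undup_id ?iota_uniq.
have := hind J B mB; rewrite (perm_big _ Jp)/=.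
have -> : (\prod_(i < n) N01 (B i) = \prod_(i <- iota 0 n) P (xi i @^-1` B i))%E.
  rewrite -(big_mkord xpredT (fun i => N01 (B i))) /index_iota subn0.
  by apply: eq_bigr => i _; rewrite -(hd i (B i) (mB i)).
move=> <-; congr (P _); apply/seteqP; split => w /=.
  by move=> h i _; exact: h.
move=> h i; have [ni|ni] := leqP n i; first by rewrite BT.
by apply: h => /=; rewrite JE.
Qed.

Lemma measurable_zero_at (k : nat) :
  measurable_fun [set: T] ((fun w => zero_at k (xi ^~ w)) : T -> Y).
Proof.
apply: measurable_fun_seq => i; rewrite /zero_at; case: eqP => // _.
Qed.

Definition rest (k : nat) : {mfun T >-> Y} := mfun_Sub (mem_set (measurable_zero_at k)).

(** Both events are boxes for [xi] itself, with side [A] or [setT] at position [k]; their product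
    formulas differ exactly in the factor at [k]. *)
Lemma indep_box (k : nat) (A : set R) (S : set (nat -> R)) :
  measurable A -> boxes S ->
  P ((rest k @^-1` S) `&` (xi k @^-1` A)) = (N01 A * P (rest k @^-1` S))%E.
Proof.
move=> mA [n [B [mB BT ->]]].
(* Coordinate [k] of [rest k] is constantly 0, so a side [B k] missing 0 makes both events empty. *)
have [B0|nB0] := pselect (B k 0); last first.
  rewrite (_ : rest k @^-1` _ = set0) ?set0I ?measure0 ?mule0//.
  by apply/seteqP; split => // w /= /(_ k); rewrite /zero_at eqxx.
pose BA C i := if i == k then C else B i.
have mBA C i : measurable C -> measurable (BA C i) by rewrite /BA; case: ifP.
pose m := maxn n k.+1.
have BAT C i : (m <= i)%N -> BA C i = setT.
  rewrite geq_max => /andP[ni ki].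
  by rewrite /BA gtn_eqF// BT.
have km : (k < m)%N by rewrite leq_max ltnSn orbT.
have -> : (rest k @^-1` [set y | forall i, B i (y i)]) `&` (xi k @^-1` A) =
    [set w | forall i, BA A i (xi i w)].
  apply/seteqP; split => w /=.
    move=> [h Ak] i; rewrite /BA; case: eqP => [->//|/eqP ik].
    by have := h i; rewrite /zero_at (negbTE ik).
  move=> h; split; last by have := h k; rewrite /BA eqxx.
  move=> i; have := h i; rewrite /zero_at /BA.
  by case: eqP => // ->.
have -> : rest k @^-1` [set y | forall i, B i (y i)] =
    [set w | forall i, BA setT i (xi i w)].
  apply/seteqP; split => w /=.
    move=> h i; rewrite /BA; case: eqP => // /eqP ik.
    by have := h i; rewrite /zero_at (negbTE ik).
  move=> h i; have := h i; rewrite /zero_at /BA.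
  by case: eqP => // ->.
rewrite (@prob_box m)//; last 2 first.
- by move=> i; exact: mBA.
- by move=> i; exact: BAT.
rewrite (@prob_box m)//; last 2 first.
- by move=> i; exact: mBA.
- by move=> i; exact: BAT.
rewrite (bigD1 (Ordinal km))//= [in RHS](bigD1 (Ordinal km))//=.
rewrite /BA eqxx [X in (_ = _ * (X * _))%E]probability_setT mul1e.
congr (_ * _)%E; apply: eq_bigr => i /eqP ik.
by case: eqP => // ik'; case: ik; exact/val_inj.
Qed.

(** For fixed [A] both sides are finite measures in [S] which agree on the pi-system [boxes], hence
    on the sigma-algebra it generates. *)
Lemma indep_rest (k : nat) (A : set R) (S : set Y) :
  measurable A -> measurable S ->
  P ((rest k @^-1` S) `&` (xi k @^-1` A)) = (N01 A * P (rest k @^-1` S))%E.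
Proof.
move=> mA mS.
have mE : measurable (xi k @^-1` A).
  by have := @measurable_funP _ _ _ _ _ (xi k) measurableT A mA; rewrite setTI.
have NA : N01 A \is a fin_num by exact: fin_num_measure.
have N0 : 0 <= fine (N01 A) by rewrite fine_ge0.
pose m1 := pushforward (mrestr P mE) (rest k).
pose m2 := mscale (NngNum N0) (distribution P (rest k)).
have : m1 S = m2 S.
  apply: (@measure_unique _ R Y (@boxes R) (fun=> setT) _ _ _ _
    (pushforward (mrestr P mE) (rest k))
    (mscale (NngNum N0) (distribution P (rest k)))) => //.
  - exact: sigma_boxes.
  - exact: boxesI.
  - move=> _; exists 0%N, (fun=> setT); split => //.
    by apply/seteqP; split.
  - by rewrite bigcup_const//; exists 0%N.
  - move=> B /(indep_box k mA) E.
    by rewrite /= /mscale /distribution /pushforward /mrestr /= fineK.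
  - move=> _; rewrite /= /pushforward /mrestr preimage_setT setTI.
    by rewrite (le_lt_trans (probability_le1 _ _))// ltry.
by rewrite /m1 /m2 /mscale /= /pushforward /mrestr fineK.
Qed.

Let pair (k : nat) (w : T) : measurableTypeR R * Y := (xi k w, rest k w).

Let measurable_pair (k : nat) : measurable_fun [set: T] (pair k).
Proof.
apply: measurable_fun_pair.
- exact: (@measurable_funP _ _ _ _ _ (xi k)).
- exact: (@measurable_funP _ _ _ _ _ (rest k)).
Qed.

Let mpair k : {mfun T >-> (measurableTypeR R * Y)%type} := mfun_Sub (mem_set (measurable_pair k)).

Lemma joint_law (k : nat) (A : set (measurableTypeR R * Y)) : measurable A ->
  (N01 \x distribution P (rest k))%E A = distribution P (mpair k) A.
Proof.
move=> mA; refine (@product_measure_unique _ _ _ _ R N01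
  (distribution P (rest k)) (distribution P (mpair k)) _ A mA) => B C mB mC.
rewrite /distribution/= /pushforward -indep_rest//; congr (P _).
by apply/seteqP; split => w /= [].
Qed.

(** The inner integral runs over coordinate [k] with the others frozen, so a one-dimensional
    Gaussian bound can be applied pointwise in [y]. *)
Lemma ge0_integral_indep (k : nat) (F : measurableTypeR R * Y -> \bar R) :
  measurable_fun [set: measurableTypeR R * Y] F -> (forall z, 0 <= F z)%E ->
  (\int[P]_w F (xi k w, (zero_at k (xi ^~ w) : Y)) =
   \int[distribution P (rest k)]_y \int[N01]_x F (x, y))%E.
Proof.
move=> mF F0.
transitivity (\int[distribution P (mpair k)]_z F z)%E.
  by rewrite ge0_integral_distribution.
rewrite -(fubini_tonelli2 F)//.
by apply: eq_measure_integral => A mA _; exact/esym/joint_law.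
Qed.

Lemma integral_indep_eq0 (k : nat) (f : R -> R) (g : Y -> R) :
  measurable_fun [set: R] f -> measurable_fun [set: Y] g ->
  N01.-integrable [set: R] (EFin \o f) -> (\int[N01]_x (f x)%:E = 0)%E ->
  P.-integrable [set: T]
    (fun w => (f (xi k w) * g (zero_at k (xi ^~ w) : Y))%:E) ->
  (\int[P]_w (f (xi k w) * g (zero_at k (xi ^~ w) : Y))%R%:E = 0)%E.
Proof.
move=> mf mg fint f0 fg.
pose F (z : measurableTypeR R * Y) := (f z.1 * g z.2)%:E.
have mF : measurable_fun [set: measurableTypeR R * Y] F.
  apply/measurable_EFinP; apply: measurable_funM.
    by apply: measurableT_comp mf _ => //; exact: measurable_fst.
  by apply: measurableT_comp mg _ => //; exact: measurable_snd.
transitivity (\int[distribution P (mpair k)]_z F z)%E.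
  by rewrite integral_distribution.
transitivity (\int[(N01 \x distribution P (rest k))%E]_z F z)%E.
  by apply: eq_measure_integral => A mA _; exact/esym/joint_law.
rewrite -integral21_prod_meas1.
  rewrite (eq_integral (cst 0%E)) ?integral0// => y _.
  rewrite /fubini_G /F /=.
  under eq_integral do rewrite mulrC EFinM.
  by rewrite integralZl// f0 mule0.
apply/integrableP; split => //.
rewrite (eq_measure_integral (distribution P (mpair k))); last first.
  by move=> A mA _; exact: joint_law.
rewrite ge0_integral_distribution//; last exact: measurableT_comp.
by have /integrableP[] := fg.
Qed.

End independence.

(** * Expectations of functions of the noise *)

Section noise_functionals.
Context d (T : measurableType d) (R : realType) (P : probability T R).
Variable xi : nat -> {RV P >-> R}.
Hypothesis hxi : iid_std_normal xi.
Local Notation N01 := (@normal_prob R 0 1).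
Local Notation Y := (g_sigma_algebraType (@cylinders R)).

Lemma ge0_integral_noise (k : nat) (f : R -> \bar R) :
  measurable_fun [set: R] f -> (forall x, 0 <= f x)%E ->
  (\int[P]_w f (xi k w) = \int[N01]_x f x)%E.
Proof.
move=> mf f0.
have mx : measurable_fun [set: T] (xi k : T -> measurableTypeR R).
  exact: (@measurable_funP _ _ _ _ _ (xi k)).
transitivity (\int[pushforward P (xi k : T -> measurableTypeR R)]_x f x)%E.
  by rewrite ge0_integral_pushforward.
by apply: eq_measure_integral => // A mA _; exact: hxi.1.
Qed.

Lemma E_obsE e eta f :
  E_obs xi e eta f = fine (\int[P]_w (f (observation xi e eta w))%:E).
Proof. by rewrite /E_obs unlock. Qed.

Lemma measurable_observation e eta :
  measurable_fun [set: T] (observation xi e eta : T -> Y).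
Proof.
apply: measurable_fun_seq => k; rewrite /observation.
by apply: measurable_funD => //; apply: measurable_funM.
Qed.

Lemma expectation_le_bound (f g : T -> R) (V : R) :
  measurable_fun [set: T] f -> measurable_fun [set: T] g ->
  (forall w, 0 <= f w <= g w) -> (\int[P]_w (g w)%:E <= V%:E)%E ->
  fine (\int[P]_w (f w)%:E) <= V.
Proof.
move=> mf mg fg gV.
have f0 : (0 <= \int[P]_w (f w)%:E)%E.
  by apply: integral_ge0 => w _; rewrite lee_fin; have /andP[] := fg w.
have fV : (\int[P]_w (f w)%:E <= V%:E)%E.
  apply: le_trans gV; apply: ge0_le_integral => //.
  - by move=> w _; rewrite lee_fin; have /andP[] := fg w.
  - exact/measurable_EFinP.
  - exact/measurable_EFinP.
  - by move=> w _; rewrite lee_fin; have /andP[] := fg w.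
rewrite -lee_fin fineK// ge0_fin_numE//.
by rewrite (le_lt_trans fV)// ltry.
Qed.

Lemma unit_integral_fin (f : T -> R) :
  measurable_fun [set: T] f -> (forall w, 0 <= f w <= 1) ->
  (\int[P]_w (f w)%:E)%E \is a fin_num.
Proof.
move=> mf f01; rewrite ge0_fin_numE; last first.
  by apply: integral_ge0 => w _; rewrite lee_fin; have /andP[] := f01 w.
apply: (@le_lt_trans _ _ (\int[P]_w cst 1%E w)%E).
  apply: ge0_le_integral => //.
  - by move=> w _; rewrite lee_fin; have /andP[] := f01 w.
  - exact/measurable_EFinP.
  - by move=> w _; rewrite lee_fin; have /andP[] := f01 w.
by rewrite integral_cst// mul1e [X in (X < _)%E]probability_setT ltry.
Qed.

Lemma integral_noise_sqr (k : nat) : (\int[P]_w ((xi k w) ^+ 2)%:E = 1)%E.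
Proof.
rewrite -(@normal_second_moment R).
rewrite (@ge0_integral_noise k (fun x => (x ^+ 2)%:E))//.
- by apply/measurable_EFinP; exact: measurable_funX.
- by move=> x; rewrite lee_fin sqr_ge0.
Qed.

Lemma integral_noise_sum_sqr (m : nat) :
  (\int[P]_w (\sum_(k < m) (xi k w) ^+ 2)%R%:E = m%:R%:E)%E.
Proof.
under eq_integral do rewrite -sumEFin.
rewrite ge0_integral_sum//; last 2 first.
- by move=> k; apply/measurable_EFinP; exact: measurable_funX.
- by move=> k w _; rewrite lee_fin sqr_ge0.
under eq_bigr do rewrite integral_noise_sqr.
by rewrite sumEFin sumr_const card_ord.
Qed.

(** Given the other coordinates, the two hypotheses differ by a shift [t] of the single variable
    [xi j]; [normal_shift_le] holds for each frozen remainder and is then integrated over it. *)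
Lemma E_obs_single_coord (f : (nat -> R) -> R) (e t : R) (j : nat)
    (eta : nat -> R) :
  measurable_fun [set: Y] (f : Y -> R) -> (forall y, 0 <= f y <= 1) ->
  0 < t <= 2^-1 -> eta j = e * t -> (forall i, i != j -> eta i = 0) ->
  E_obs xi e (fun=> 0) f <= E_obs xi e eta f + 2 * t.
Proof.
move=> mf f01 t01 etaj etai.
(* Rebuilds the observation from the noise [x] at coordinate [j] and the noise [z] elsewhere; adding
   [t] to [x] produces the signal [e * t]. *)
pose ins (x : R) (z : nat -> R) : Y := fun i => e * (if i == j then x else z i).
have mins c : measurable_fun [set: measurableTypeR R * Y]
    (fun z : measurableTypeR R * Y => ins (z.1 + c) z.2).
  apply: measurable_fun_seq => i; rewrite /ins; apply: measurable_funM => //.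
  case: (i == j); first exact: measurable_funD.
  by apply: measurableT_comp (measurable_coord i) _ => //; exact: measurable_snd.
pose Fc c (z : measurableTypeR R * Y) := (f (ins (z.1 + c) z.2))%:E.
have mFc c : measurable_fun [set: measurableTypeR R * Y] (Fc c).
  by apply/measurable_EFinP; apply: measurableT_comp mf _ => //; exact: mins.
have Fc0 c z : (0 <= Fc c z)%E by rewrite lee_fin; have /andP[] := f01 (ins (z.1 + c) z.2).
have E0 : (\int[P]_w (f (observation xi e (fun=> 0) w))%:E =
    \int[distribution P (rest xi j)]_y \int[N01]_x Fc 0%R (x, y))%E.
  rewrite -ge0_integral_indep//; apply: eq_integral => w _.
  rewrite /Fc /=; congr (f _)%:E; apply/funext => i.
  by rewrite /observation /ins /zero_at add0r addr0; case: eqP => // ->.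
have E1 : (\int[P]_w (f (observation xi e eta w))%:E =
    \int[distribution P (rest xi j)]_y \int[N01]_x Fc t (x, y))%E.
  rewrite -ge0_integral_indep//; apply: eq_integral => w _.
  rewrite /Fc /=; congr (f _)%:E; apply/funext => i.
  rewrite /observation /ins /zero_at; case: eqP => [->|/eqP ij].
    by rewrite etaj -mulrDr addrC.
  by rewrite etai// add0r.
have le : (\int[P]_w (f (observation xi e (fun=> 0) w))%:E <=
    \int[P]_w (f (observation xi e eta w))%:E + (2 * t)%:E)%E.
  rewrite E0 E1.
  have -> : (2 * t)%:E = (\int[distribution P (rest xi j)]_y cst (2 * t)%:E y)%E.
    by rewrite integral_cst// [X in (_ * X)%E]probability_setT mule1.
  have t0 : 0 <= 2 * t by rewrite mulr_ge0// ltW//; have /andP[] := t01.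
  have mG c : measurable_fun [set: Y] (fun y => \int[N01]_x Fc c (x, y))%E.
    exact: measurable_fun_fubini_tonelli_G.
  have G0 c y : (0 <= \int[N01]_x Fc c (x, y))%E by apply: integral_ge0.
  rewrite -ge0_integralD//.
  apply: ge0_le_integral => //.
  - exact: emeasurable_funD.
  move=> y _.
  pose g x := f (ins x y).
  have mg : measurable_fun [set: R] g.
    apply: measurableT_comp mf _ => //; apply: measurable_fun_seq => i.
    by rewrite /ins; apply: measurable_funM => //; case: (i == j).
  have := normal_shift_le mg (fun x => f01 _) t01.
  by rewrite /Fc /=; under [X in (X <= _)%E -> _]eq_integral do rewrite -[X in g X]addr0.
have mo et : measurable_fun [set: T] (fun w => f (observation xi e et w)).
  by apply: measurableT_comp mf _ => //; exact: measurable_observation.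
rewrite !E_obsE -lee_fin EFinD !fineK//; exact: unit_integral_fin.
Qed.

(** Second moments add up because centred functions of distinct coordinates are orthogonal; by
    induction, only the last summand has to be separated from the preceding sum. *)
Lemma integral_sqr_indep_sum (f : nat -> R -> R) (v : nat -> R) (n : nat) :
  (forall k, measurable_fun [set: R] (f k)) ->
  (forall k, N01.-integrable [set: R] (EFin \o f k)) ->
  (forall k, \int[N01]_x (f k x)%:E = 0)%E ->
  (forall k, \int[N01]_x ((f k x) ^+ 2)%R%:E <= (v k)%:E)%E ->
  (\int[P]_w ((\sum_(k < n) f k (xi k w)) ^+ 2)%R%:E <= (\sum_(k < n) v k)%R%:E)%E.
Proof.
move=> mf fint f0 fv.
have mfx k : measurable_fun [set: T] (fun w => f k (xi k w)).
  exact: measurableT_comp.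
have mS m : measurable_fun [set: T] (fun w => \sum_(k < m) f k (xi k w)).
  exact: measurable_sum.
have sqr_int (g : T -> R) V : measurable_fun [set: T] g ->
    (\int[P]_w ((g w) ^+ 2)%R%:E <= V%:E)%E ->
    P.-integrable [set: T] (fun w => ((g w) ^+ 2)%:E).
  move=> mg gV; apply/integrableP; split.
    by apply/measurable_EFinP; exact: measurable_funX.
  under eq_integral do rewrite gee0_abs ?lee_fin ?sqr_ge0//.
  exact: le_lt_trans (ltry V).
have fsq k : (\int[P]_w ((f k (xi k w)) ^+ 2)%R%:E <= (v k)%:E)%E.
  rewrite (@ge0_integral_noise k (fun x => ((f k x) ^+ 2)%:E))//.
  - by apply/measurable_EFinP; exact: measurable_funX.
  - by move=> x; rewrite lee_fin sqr_ge0.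
elim: n => [|n IH].
  rewrite big_ord0; under eq_integral do rewrite big_ord0 expr0n.
  by rewrite integral0.
set S := fun w => \sum_(k < n) f k (xi k w).
have iS := sqr_int _ _ (mS n) IH.
have iF := sqr_int _ _ (mfx n) (fsq n).
(* The product is dominated by the sum of the two squares, both integrable by now. *)
have iSF : P.-integrable [set: T] (fun w => (f n (xi n w) * S w)%:E).
  apply: le_integrable (integrableD measurableT iS iF) => //.
    by apply/measurable_EFinP; apply: measurable_funM; [exact: mfx|exact: mS].
  move=> w _; rewrite /= lee_fin; apply: le_trans (ler_norm _).
  rewrite -/(S w) normrM; move: (f n (xi n w)) (S w) => a b.
  rewrite -[a ^+ 2]real_normK ?num_real// -[b ^+ 2]real_normK ?num_real//.
  move: (`|a|) (`|b|) (normr_ge0 a) (normr_ge0 b) => {}a {}b a0 b0; nra.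
have SF0 : (\int[P]_w (f n (xi n w) * S w)%R%:E = 0)%E.
  (* The partial sum reads only coordinates below [n], so zeroing coordinate [n] leaves it unchanged
     and it is a function of [rest n]. *)
  pose h (y : Y) : R := \sum_(k < n) f k (y k).
  have mh : measurable_fun [set: Y] h.
    apply: measurable_sum => k; apply: measurableT_comp (mf k) _ => //.
    exact: measurable_coord.
  have hS w : h (zero_at n (xi ^~ w)) = S w.
    by apply: eq_bigr => k _; rewrite /zero_at ltn_eqF.
  transitivity (\int[P]_w (f n (xi n w) * h (zero_at n (xi ^~ w)))%R%:E)%E.
    by apply: eq_integral => w _; rewrite hS.
  apply: (@integral_indep_eq0 _ _ _ _ _ hxi n (f n) h) => //.
  by apply: eq_integrable iSF => // w _; rewrite hS.
have -> : (\int[P]_w ((\sum_(k < n.+1) f k (xi k w)) ^+ 2)%R%:E =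
    \int[P]_w (((S w) ^+ 2)%:E + ((f n (xi n w)) ^+ 2)%:E +
      2%:E * (f n (xi n w) * S w)%R%:E))%E.
  apply: eq_integral => w _; rewrite big_ord_recr/= -EFinM -!EFinD; congr EFin.
  by rewrite -/(S w); ring.
rewrite integralD//; last 2 first.
- exact: integrableD.
- exact: integrableZl.
rewrite integralZl// SF0 mule0 adde0 integralD//.
by rewrite big_ord_recr/= EFinD leeD.
Qed.

End noise_functionals.

(** * Ellipsoids and the extreme sequence *)

Section nonneg_series.
Context (R : realType).
Implicit Types (f : nat -> R) (M : R).

Lemma nnseries_le_bound f M (n0 : nat) : (forall k, 0 <= f k) ->
  (forall n, (n0 <= n)%N -> \sum_(k < n) f k <= M) ->
  (\sum_(k <oo) (f k)%:E <= M%:E)%E.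
Proof.
move=> f0 h; apply: lime_le.
  by apply: is_cvg_nneseries => k _ _; rewrite lee_fin.
exists n0 => // n /= nn; rewrite sumEFin lee_fin big_mkord; exact: h.
Qed.

Lemma nnseries_ge_partial f M (n : nat) : (forall k, 0 <= f k) ->
  (\sum_(k <oo) (f k)%:E <= M%:E)%E -> \sum_(k < n) f k <= M.
Proof.
move=> f0; rewrite -lee_fin; apply: le_trans.
rewrite -(big_mkord xpredT f) -sumEFin; apply: nneseries_lim_ge => k _ _.
by rewrite lee_fin.
Qed.

Lemma nnseries_finite f (n : nat) : (forall k, 0 <= f k) ->
  (forall k, (n <= k)%N -> f k = 0) ->
  (\sum_(k <oo) (f k)%:E = (\sum_(k < n) f k)%:E)%E.
Proof.
move=> f0 fn; rewrite (@nneseries_split _ _ 0 n); last by move=> k _; rewrite lee_fin.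
rewrite add0n eseries0 ?adde0 ?sumEFin ?big_mkord// => i ni _.
by rewrite fn.
Qed.

Lemma lim_series_finite (u : nat -> R) (n : nat) :
  (forall k, (n <= k)%N -> u k = 0) -> limn (series u) = \sum_(k < n) u k.
Proof.
move=> u0; apply/cvg_lim => //; apply: cvg_near_cst.
exists n => // m /= nm; rewrite /series/= (big_cat_nat _ nm)//=.
have -> : \sum_(n <= i < m) u i = 0 by rewrite big_nat big1// => i /andP[/u0].
by rewrite addr0 big_mkord.
Qed.

End nonneg_series.

Section ellipsoids.
Context (R : realType).
Variables a s : nat -> R.

Lemma Theta2_sum (eta : nat -> R) (n : nat) : Theta a s 2 eta ->
  \sum_(k < n) (a k) ^+ 2 * (s k) ^+ 2 * (eta k) ^+ 2 <= 1.
Proof.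
move=> [_ h]; rewrite (eq_bigr (fun k : 'I_n => `|a k * s k * eta k| `^ 2)).
  by apply: (nnseries_ge_partial (f := fun k => `|a k * s k * eta k| `^ 2)) h => k; exact: powR_ge0.
by move=> k _; rewrite powR_mulrn// real_normK ?num_real// !exprMn.
Qed.

(** No term of the [q]-sum can exceed 1, and on [[0, 1]] the square lies below the [q]-th power. *)
Lemma Theta_sub (q : R) (eta : nat -> R) : 0 < q -> q <= 2 ->
  Theta a s q eta -> Theta a s 2 eta.
Proof.
move=> q0 q2 [h2 hq]; split => //.
have x1 k : `|a k * s k * eta k| <= 1.
  rewrite leNgt; apply/negP => x1.
  have h1 := nnseries_ge_partial k.+1 (fun k => powR_ge0 `|a k * s k * eta k| q) hq.
  have : 1 < `|a k * s k * eta k| `^ q.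
    have <- : 1 `^ q = 1 :> R by rewrite powR1.
    by apply: gt0_ltr_powR => //; rewrite ?nnegrE.
  apply/negP; rewrite -leNgt; apply: le_trans h1.
  by rewrite big_ord_recr/= lerDr sumr_ge0// => i _; exact: powR_ge0.
apply: le_trans hq; apply: lee_nneseries => [k _ _|k _]; rewrite lee_fin; first exact: powR_ge0.
have [->|x0] := eqVneq `|a k * s k * eta k| 0.
  by rewrite !powR0// gt_eqF.
by apply: ger_powR => //; rewrite x1 andbT lt_neqAle eq_sym x0 normr_ge0.
Qed.

Lemma Theta_r_sub (q r : R) : 0 < q -> q <= 2 ->
  Theta_r a s q r `<=` Theta_r a s 2 r.
Proof. by move=> q0 q2 eta [/(Theta_sub q0 q2)]. Qed.

End ellipsoids.

(** * The extreme sequence as a minimiser *)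

Section extreme.
Context (R : realType).
Variables (a s : nat -> R) (r z0 A : R) (et : nat -> R) (n : nat).
Hypothesis A0 : 0 <= A.
Hypothesis an : forall k, (n <= k)%N -> 1 <= A * (a k) ^+ 2.
Hypothesis et_sqr : forall k,
  (et k) ^+ 2 = z0 ^+ 2 * (s k) ^+ 2 * Num.max 0 (1 - A * (a k) ^+ 2).
Hypothesis sum_s :
  (\sum_(k <oo) ((s k) ^+ 2 * (et k) ^+ 2)%:E)%E = (r ^+ 2)%:E.
Hypothesis sum_as :
  (\sum_(k <oo) ((a k) ^+ 2 * (s k) ^+ 2 * (et k) ^+ 2)%:E)%E = 1%E.

Lemma extreme_tail k : (n <= k)%N -> et k = 0.
Proof.
move=> nk; apply/eqP; rewrite -sqrf_eq0 et_sqr.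
by rewrite max_l ?mulr0// subr_le0 an.
Qed.

Let tail2 k : (n <= k)%N -> (et k) ^+ 2 = 0.
Proof. by move/extreme_tail->; rewrite expr0n. Qed.

Let sum_sn : \sum_(k < n) (s k) ^+ 2 * (et k) ^+ 2 = r ^+ 2.
Proof.
apply: EFin_inj; rewrite -sum_s (@nnseries_finite _ _ n)// => k.
- by rewrite mulr_ge0 ?sqr_ge0.
- by move/tail2->; rewrite mulr0.
Qed.

Let sum_asn : \sum_(k < n) (a k) ^+ 2 * (s k) ^+ 2 * (et k) ^+ 2 = 1.
Proof.
apply: EFin_inj; rewrite -sum_as (@nnseries_finite _ _ n)// => k.
- by rewrite mulr_ge0 ?sqr_ge0// mulr_ge0 ?sqr_ge0.
- by move/tail2->; rewrite mulr0.
Qed.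

(** Substituting the formula for one of the two factors [et k ^+ 2] turns the sum into [z0^2] times
    the first constraint minus [A] times the second, whose values are [r^2] and 1. *)
Lemma extreme_energy : \sum_(k < n) (et k) ^+ 4 = z0 ^+ 2 * (r ^+ 2 - A).
Proof.
rewrite -sum_sn -[A in RHS]mulr1 -sum_asn mulr_sumr -sumrB mulr_sumr.
apply: eq_bigr => k _.
have -> : et k ^+ 4 = (et k ^+ 2) * (et k ^+ 2) by ring.
have [->|e0] := eqVneq (et k ^+ 2) 0; first by rewrite !mulr0 subr0 mulr0.
have : et k ^+ 2 = z0 ^+ 2 * (s k) ^+ 2 * (1 - A * (a k) ^+ 2).
  rewrite et_sqr; case: leP => // h.
  by move: e0; rewrite et_sqr max_l ?mulr0 ?eqxx ?ltW.
by move=> E; rewrite {1}E; ring.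
Qed.

(* The extreme sequence maximises the Lagrangian
   [\sum (1 - A a_k^2) s_k^2 v_k], and dropping the terms with [k >= n] can
   only increase it. *)
Lemma extreme_min (eta : nat -> R) : Theta_r a s 2 r eta ->
  \sum_(k < n) (et k) ^+ 4 <= \sum_(k < n) (et k) ^+ 2 * (eta k) ^+ 2.
Proof.
move=> [th hr]; rewrite extreme_energy.
pose L m := \sum_(k < m) (1 - A * a k ^+ 2) * (s k ^+ 2 * eta k ^+ 2).
have LE m : L m = \sum_(k < m) s k ^+ 2 * eta k ^+ 2 -
    A * \sum_(k < m) a k ^+ 2 * s k ^+ 2 * eta k ^+ 2.
  by rewrite mulr_sumr -sumrB; apply: eq_bigr => k _; ring.
have Ln m : (n <= m)%N -> L m <= L n.
  move=> nm; rewrite /L -!(big_mkord xpredT (fun k => (1 - A * a k ^+ 2) * (s k ^+ 2 * eta k ^+ 2))).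
  rewrite (big_cat_nat (leq0n n) nm)/= gerDl big_nat sumr_le0// => k /andP[nk _].
  by rewrite mulr_le0_ge0 ?subr_le0 ?an// mulr_ge0 ?sqr_ge0.
(* Stated as [r^2 <= L n + A] and checked on partial sums of length at least [n], which avoids
   subtracting infinite series. *)
have rL : r ^+ 2 - A <= L n.
  rewrite lerBlDr -lee_fin; apply: le_trans hr _.
  apply: (@nnseries_le_bound _ (fun k => s k ^+ 2 * eta k ^+ 2) _ n) => [k|m nm].
    by rewrite mulr_ge0 ?sqr_ge0.
  have := Ln _ nm; rewrite (LE m) => h.
  have : A * \sum_(k < m) a k ^+ 2 * s k ^+ 2 * eta k ^+ 2 <= A.
    by rewrite ler_piMr// Theta2_sum.
  lra.
apply: (@le_trans _ _ (z0 ^+ 2 * L n)); first by rewrite ler_wpM2l ?sqr_ge0.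
rewrite /L mulr_sumr; apply: ler_sum => k _.
rewrite et_sqr.
have -> : z0 ^+ 2 * ((1 - A * a k ^+ 2) * (s k ^+ 2 * eta k ^+ 2)) =
  z0 ^+ 2 * s k ^+ 2 * (1 - A * a k ^+ 2) * eta k ^+ 2 by ring.
apply: ler_wpM2r; first exact: sqr_ge0.
apply: ler_wpM2l; first by rewrite mulr_ge0 ?sqr_ge0.
by rewrite le_max lexx orbT.
Qed.

Lemma extreme_in : Theta_r a s 2 r et.
Proof.
split; last by rewrite sum_s.
split.
  rewrite /l2/= (@nnseries_finite _ (fun k => et k ^+ 2) n) ?ltry// => k.
  exact: sqr_ge0.
rewrite -sum_as le_eqVlt; apply/orP; left; apply/eqP.
apply: eq_eseriesr => k _; congr EFin.
by rewrite powR_mulrn// real_normK ?num_real// !exprMn.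
Qed.

(** The infimum is attained at [et]: [extreme_min] and [2xy <= x^2 + y^2] bound the sum of [et^4] by
    half of itself plus half of the sum of [eta^4]. *)
Lemma u_val_extreme (e : R) :
  u_val a s e r = Num.sqrt ((2 * e ^+ 4)^-1 * \sum_(k < n) (et k) ^+ 4).
Proof.
rewrite /u_val; congr (Num.sqrt (_ * _)).
suff -> : ereal_inf [set (\sum_(k <oo) ((eta k) ^+ 4)%:E)%E
    | eta in Theta_r a s 2 r] = (\sum_(k < n) (et k) ^+ 4)%:E by [].
apply/eqP; rewrite eq_le; apply/andP; split.
  apply: ereal_inf_lbound; exists et; first exact: extreme_in.
  rewrite (@nnseries_finite _ (fun k => et k ^+ 4) n) => // k.
    by rewrite exprn_even_ge0.
  by move/extreme_tail->; rewrite expr0n.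
apply: le_ereal_inf_tmp => _ [eta heta <-].
apply: (@le_trans _ _ (\sum_(k < n) eta k ^+ 4)%:E); last first.
  rewrite -(big_mkord xpredT (fun k => eta k ^+ 4)) -sumEFin.
  by apply: nneseries_lim_ge => k _ _; rewrite lee_fin exprn_even_ge0.
rewrite lee_fin; have := extreme_min heta.
have : \sum_(k < n) et k ^+ 2 * eta k ^+ 2 <=
    \sum_(k < n) (et k ^+ 4 + eta k ^+ 4) / 2.
  apply: ler_sum => k _.
  have := sqr_ge0 (et k ^+ 2 - eta k ^+ 2).
  have -> : et k ^+ 4 = et k ^+ 2 * et k ^+ 2 by ring.
  have -> : eta k ^+ 4 = eta k ^+ 2 * eta k ^+ 2 by ring.
  by rewrite expr2; lra.
by rewrite -mulr_suml big_split/=; lra.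
Qed.

End extreme.

(** Finiteness of the first constraint forces [A > 0], and then [1 - A a_k^2] is eventually
    nonpositive. This makes the extreme sequence finitely supported, so every later sum is
    finite. *)
Lemma extreme_sequence_cutoff (R : realType) (alpha beta r : R) (et : nat -> R) :
  0 < alpha -> 0 < beta -> 0 < r ->
  extreme_sequence (pow_seq alpha) (exp_seq beta) r et ->
  exists z0 A : R, exists n : nat,
    [/\ 0 <= A, forall k, (n <= k)%N -> 1 <= A * (pow_seq alpha k) ^+ 2,
      forall k, (et k) ^+ 2 = z0 ^+ 2 * (exp_seq beta k) ^+ 2 *
        Num.max 0 (1 - A * (pow_seq alpha k) ^+ 2),
      (\sum_(k <oo) ((exp_seq beta k) ^+ 2 * (et k) ^+ 2)%:E)%E = (r ^+ 2)%:E &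
      (\sum_(k <oo) ((pow_seq alpha k) ^+ 2 * (exp_seq beta k) ^+ 2 *
         (et k) ^+ 2)%:E)%E = 1%E].
Proof.
move=> al0 be0 r0 [z0 [A [_ etE sumr sum1]]].
have s1 k : 1 <= exp_seq beta k.
  by rewrite /exp_seq -expR0 ler_expR mulr_ge0// ltW.
have z00 : z0 != 0.
  apply/eqP => z00; have : (r ^+ 2)%:E = 0%E.
    rewrite -sumr eseries0// => k _ _.
    by rewrite etE z00 expr0n/= !mul0r mulr0.
  by case=> /eqP; rewrite sqrf_eq0 gt_eqF.
have z2 : 0 < z0 ^+ 2 by rewrite exprn_even_gt0.
have A0 : 0 < A.
  rewrite ltNge; apply/negP => A0.
  (* If [A <= 0], each term of the first constraint is at least [z0^2], and [N > r^2 / z0^2] of them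
     exceed its value [r^2]. *)
  pose N := (Num.trunc (r ^+ 2 / z0 ^+ 2)).+1.
  have : \sum_(k < N) (exp_seq beta k) ^+ 2 * (et k) ^+ 2 <= r ^+ 2.
    apply: (nnseries_ge_partial (f := fun k => (exp_seq beta k) ^+ 2 * (et k) ^+ 2)).
      by move=> k; rewrite mulr_ge0 ?sqr_ge0.
    by rewrite sumr.
  apply/negP; rewrite -ltNge.
  apply: (@lt_le_trans _ _ (\sum_(k < N) z0 ^+ 2)).
    rewrite sumr_const card_ord -mulr_natr -ltr_pdivrMl// mulrC.
    exact: truncnS_gt.
  apply: ler_sum => k _; rewrite etE.
  have s2 : 1 <= exp_seq beta k ^+ 2 by rewrite exprn_ege1.
  have m1 : 1 <= Num.max 0 (1 - A * pow_seq alpha k ^+ 2).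
    by rewrite le_max lerBrDr gerDl mulr_le0_ge0 ?sqr_ge0 ?orbT.
  move: (exp_seq beta k ^+ 2) (Num.max 0 (1 - A * pow_seq alpha k ^+ 2)) s2 m1.
  move=> S M S1 M1.
  have -> : S * (z0 ^+ 2 * S * M) = z0 ^+ 2 * (S * (S * M)) by ring.
  by rewrite ler_peMr ?(ltW z2)// mulr_ege1// mulr_ege1.
(* The real solution of [A x^(2 alpha) = 1]. Position [k] carries the index [k + 1], so
   [k >= trunc x] already gives an index above [x]. *)
pose x := A^-1 `^ ((2 * alpha)^-1).
exists z0, A, (Num.trunc x); split => //; first exact: ltW.
move=> k nk.
have xk : x < k.+1%:R by apply: lt_le_trans (truncnS_gt x) _; rewrite ler_nat.
rewrite -ler_pdivrMl// mulr1 /pow_seq.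
have -> : A^-1 = (x `^ alpha) ^+ 2.
  rewrite -powR_mulrn ?powR_ge0// -!powRrM.
  have -> : (2 * alpha)^-1 * (alpha * 2) = 1 by field; rewrite gt_eqF.
  by rewrite powRr1// invr_ge0 ltW.
rewrite ler_sqr ?nnegrE ?powR_ge0//.
by rewrite ge0_ler_powR ?nnegrE ?powR_ge0// ltW.
Qed.

Section quadratic_statistic.
Context d (T : measurableType d) (R : realType) (P : probability T R).
Variable xi : nat -> {RV P >-> R}.
Hypothesis hxi : iid_std_normal xi.
Local Notation N01 := (@normal_prob R 0 1).

(** With [t k = eta k / e], the bracket is [(y k / e)^2 - 1] minus its mean [t k ^+ 2]. The
    constants come from [(p + q)^2 <= 2 p^2 + 2 q^2] with [p = 2 t x], whose square has mean
    [4 t^2]. *)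
Lemma quadratic_second_moment (C : R) (w t : nat -> R) (n : nat) :
  0 <= C -> (\int[N01]_x ((x ^+ 2 - 1) ^+ 2)%R%:E <= C%:E)%E ->
  (\int[P]_v ((\sum_(k < n) w k * (2 * t k * xi k v + (xi k v ^+ 2 - 1))) ^+ 2)%R%:E
   <= (\sum_(k < n) (w k) ^+ 2 * (8 * (t k) ^+ 2 + 2 * C))%R%:E)%E.
Proof.
move=> C0 hC.
pose f k (x : R) := w k * (2 * t k * x + (x ^+ 2 - 1)).
have mx2 : measurable_fun [set: R] (fun x : R => x ^+ 2 - 1).
  by apply: measurable_funB => //; exact: measurable_funX.
have mf k : measurable_fun [set: R] (f k).
  by apply: measurable_funM => //; apply: measurable_funD.
have i1 := @integrable_normal_id R.
have i2 := @integrable_normal_sqr R.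
have ic (c : R) : N01.-integrable [set: R] (cst c%:E).
  exact: finite_measure_integrable_cst.
have i3 := integrableB measurableT i2 (ic 1).
have i4 k := integrableZl measurableT (2 * t k) i1.
have i5 k := integrableZl measurableT (w k) (integrableD measurableT (i4 k) i3).
have fint k : N01.-integrable [set: R] (EFin \o f k).
  apply: eq_integrable (i5 k) => // x _.
apply: (@integral_sqr_indep_sum _ _ _ _ _ hxi f
  (fun k => (w k) ^+ 2 * (8 * (t k) ^+ 2 + 2 * C)) n) => // k.
- transitivity (\int[N01]_x ((w k)%:E * ((2 * t k)%:E * x%:E + ((x ^+ 2)%R%:E - 1))))%E.
    by [].
  rewrite integralZl//; last exact: (integrableD measurableT (i4 k) i3).
  rewrite integralD//.
  rewrite integralZl// normal_mean mule0 add0e integralB//; last exact: ic.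
  rewrite normal_second_moment integral_cst// mul1e.
  by rewrite [X in (_ * (_ - X))%E]probability_setT subee// mule0.
- have m2 (c : R) : measurable_fun [set: R] (fun x : R => c%:E * (x ^+ 2)%R%:E)%E.
    by apply/measurable_EFinP; apply: measurable_funM => //; exact: measurable_funX.
  have m4 (c : R) : measurable_fun [set: R] (fun x : R => c%:E * ((x ^+ 2 - 1) ^+ 2)%R%:E)%E.
    by apply/measurable_EFinP; apply: measurable_funM => //; exact: measurable_funX.
  have : (\int[N01]_x ((f k x) ^+ 2)%R%:E <=
     \int[N01]_x (((w k) ^+ 2 * (8 * (t k) ^+ 2))%R%:E * (x ^+ 2)%R%:E +
     ((w k) ^+ 2 * 2)%R%:E * ((x ^+ 2 - 1) ^+ 2)%R%:E))%E.
    apply: ge0_le_integral => //.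
    + by move=> x _; rewrite lee_fin sqr_ge0.
    + by apply/measurable_EFinP; apply: measurable_funX; exact: mf.
    + by apply: emeasurable_funD; [exact: m2|exact: m4].
    move=> x _; rewrite -!EFinM -EFinD lee_fin /f exprMn.
    have -> : w k ^+ 2 * (8 * t k ^+ 2) * x ^+ 2 + w k ^+ 2 * 2 * (x ^+ 2 - 1) ^+ 2 =
      w k ^+ 2 * (8 * t k ^+ 2 * x ^+ 2 + 2 * (x ^+ 2 - 1) ^+ 2) by ring.
    apply: ler_wpM2l; first exact: sqr_ge0.
    have := sqr_ge0 (2 * t k * x - (x ^+ 2 - 1)).
nra.
  move=> /le_trans; apply.
  have c1 : 0 <= w k ^+ 2 * (8 * t k ^+ 2).
    by apply: mulr_ge0; rewrite ?sqr_ge0// mulr_ge0 ?sqr_ge0.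
  have c2 : 0 <= w k ^+ 2 * 2 by rewrite mulr_ge0 ?sqr_ge0.
  have mx2' : measurable_fun [set: R] (fun x : R => (x ^+ 2)%:E).
    by apply/measurable_EFinP; exact: measurable_funX.
  have mx4' : measurable_fun [set: R] (fun x : R => ((x ^+ 2 - 1) ^+ 2)%:E).
    by apply/measurable_EFinP; exact: measurable_funX.
  have p1 (x : R) : (0 <= (x ^+ 2)%R%:E)%E by rewrite lee_fin sqr_ge0.
  have p2 (x : R) : (0 <= ((x ^+ 2 - 1) ^+ 2)%R%:E)%E by rewrite lee_fin sqr_ge0.
  rewrite ge0_integralD//; try by [exact: m2|exact: m4|move=> x _; rewrite mule_ge0].
  rewrite ge0_integralZl// ge0_integralZl//.
  rewrite normal_second_moment mule1.
  have -> : w k ^+ 2 * (8 * t k ^+ 2 + 2 * C) =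
    w k ^+ 2 * (8 * t k ^+ 2) + w k ^+ 2 * 2 * C by ring.
  rewrite EFinD; apply: leeD => //; rewrite [leRHS]EFinM.
  by apply: lee_wpmul2l => //; rewrite lee_fin.
Qed.

End quadratic_statistic.

(** * Errors of the quadratic test *)

Section test_errors.
Context d (T : measurableType d) (R : realType) (P : probability T R).
Variable xi : nat -> {RV P >-> R}.
Hypothesis hxi : iid_std_normal xi.
Local Notation N01 := (@normal_prob R 0 1).
Local Notation Y := (g_sigma_algebraType (@cylinders R)).

Lemma integral_one : (\int[P]_w cst 1%E w = 1)%E.
Proof. by rewrite integral_cst// mul1e [LHS]probability_setT. Qed.

Lemma E_obs_unit e eta (f : (nat -> R) -> R) :
  measurable_fun [set: Y] (f : Y -> R) -> (forall y, 0 <= f y <= 1) ->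
  0 <= E_obs xi e eta f <= 1.
Proof.
move=> mf f01; rewrite E_obsE; apply/andP; split.
  by rewrite fine_ge0// integral_ge0// => w _; rewrite lee_fin; have /andP[] := f01 (observation xi e eta w).
apply: (@expectation_le_bound _ _ _ _ _ (cst 1)) => //.
  by apply: (measurableT_comp mf); exact: measurable_observation.
by rewrite integral_one.
Qed.

Lemma E_obs_onem e eta (f : (nat -> R) -> R) :
  measurable_fun [set: Y] (f : Y -> R) -> (forall y, 0 <= f y <= 1) ->
  E_obs xi e eta (fun y => 1 - f y) = 1 - E_obs xi e eta f.
Proof.
move=> mf f01; rewrite !E_obsE.
have mo : measurable_fun [set: T] (fun w => f (observation xi e eta w)).
  by apply: (measurableT_comp mf); exact: measurable_observation.
have fin := @unit_integral_fin _ _ _ P _ mo (fun w => f01 _).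
have fi : P.-integrable [set: T] (fun w => (f (observation xi e eta w))%:E).
  apply/integrableP; split; first exact/measurable_EFinP.
  under eq_integral do rewrite gee0_abs ?lee_fin ?(andP (f01 _)).1//.
  rewrite -ge0_fin_numE// integral_ge0// => w _; rewrite lee_fin.
  by have /andP[] := f01 (observation xi e eta w).
have ic : P.-integrable [set: T] (cst 1%E) by exact: finite_measure_integrable_cst.
rewrite -[X in _ = X - _]/(fine 1%E) -integral_one -fineB//; last by rewrite integral_one.
by rewrite -integralB//; congr fine; apply: eq_integral => v _; rewrite EFinB.
Qed.

(** The assumption [0 <= b] covers an empty set of alternatives, where the supremum takes the
    default value 0. *)
Lemma beta_err_le e (Th : set (nat -> R)) psi b : 0 <= b ->
  (forall eta, Th eta -> E_obs xi e eta (fun y => 1 - psi y) <= b) ->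
  beta_err xi e Th psi <= b.
Proof.
move=> b0 h; rewrite /beta_err.
have [[eta Theta0]|no] := pselect (exists eta, Th eta).
  apply: ge_sup; first by exists (E_obs xi e eta (fun y => 1 - psi y)), eta.
  by move=> _ [et /h ? <-].
rewrite (_ : [set _ | _ in _] = set0) ?sup0//.
by apply/seteqP; split => // x [eta Theta0 _]; case: no; exists eta.
Qed.

Lemma beta_err_ge e (Th : set (nat -> R)) psi eta : is_test psi -> Th eta ->
  E_obs xi e eta (fun y => 1 - psi y) <= beta_err xi e Th psi.
Proof.
move=> [mpsi psi01] Theta0; apply: ub_le_sup; last by exists eta.
exists 1 => _ [et _ <-].
have m1 : measurable_fun [set: Y] ((fun y => 1 - psi y) : Y -> R).
  exact: measurable_funB.
have b1 y : 0 <= 1 - psi y <= 1 by have := psi01 y; lra.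
by have /andP[] := E_obs_unit e et m1 b1.
Qed.

Lemma beta_err_ge0 e (Th : set (nat -> R)) psi : is_test psi ->
  0 <= beta_err xi e Th psi.
Proof.
move=> tpsi.
have [[eta Theta0]|no] := pselect (exists eta, Th eta).
  apply: le_trans (beta_err_ge e tpsi Theta0).
  have [mpsi psi01] := tpsi.
  have m1 : measurable_fun [set: Y] ((fun y => 1 - psi y) : Y -> R).
    exact: measurable_funB.
  have b1 y : 0 <= 1 - psi y <= 1 by have := psi01 y; lra.
  by have /andP[] := E_obs_unit e eta m1 b1.
rewrite /beta_err (_ : [set _ | _ in _] = set0) ?sup0//.
by apply/seteqP; split => // x [eta Theta0 _]; case: no; exists eta.
Qed.

Section statistic.
Variables (et : nat -> R) (n : nat).
Hypothesis et_tail : forall k, (n <= k)%N -> et k = 0.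
Let V := \sum_(k < n) (et k) ^+ 4.
Hypothesis V0 : 0 < V.

Let w := weights et.

Lemma weightsE k : weights et k = (et k) ^+ 2 / Num.sqrt (2 * V).
Proof.
rewrite /weights (@lim_series_finite _ _ n)// => i /et_tail ->.
by rewrite expr0n.
Qed.

Lemma weights_ge0 k : 0 <= w k.
Proof. by rewrite /w weightsE divr_ge0 ?sqr_ge0// sqrtr_ge0. Qed.

Lemma weights_sqr_sum : \sum_(k < n) (w k) ^+ 2 = 2^-1.
Proof.
under eq_bigr do rewrite /w weightsE exprMn exprVn sqr_sqrtr ?mulr_ge0 ?(ltW V0)//.
rewrite -mulr_suml (eq_bigr (fun k : 'I_n => et k ^+ 4)).
  by rewrite -/V; field; rewrite gt_eqF.
by move=> k _; rewrite -exprM.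
Qed.

Lemma weights_le1 (k : 'I_n) : w k <= 1.
Proof.
have : w k ^+ 2 <= 2^-1.
  rewrite -weights_sqr_sum (bigD1 k)//= lerDl sumr_ge0// => i _; exact: sqr_ge0.
by have := weights_ge0 k; nra.
Qed.

Lemma t_statE e y : t_stat et e y = \sum_(k < n) w k * ((y k / e) ^+ 2 - 1).
Proof.
rewrite /t_stat (@lim_series_finite _ _ n)// => k nk.
by rewrite weightsE et_tail// expr0n/= !mul0r.
Qed.

Lemma measurable_t_stat e : measurable_fun [set: Y] (t_stat et e : Y -> R).
Proof.
rewrite (_ : t_stat et e = fun y => \sum_(k < n) w k * ((y k / e) ^+ 2 - 1)).
  apply: measurable_sum => k; apply: measurable_funM => //.
  apply: measurable_funB => //; apply: measurable_funX; apply: measurable_funM => //.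
  exact: measurable_coord.
by apply/funext => y; exact: t_statE.
Qed.

Lemma psi_test_is_test e H : is_test (psi_test et e H).
Proof.
split; last by move=> y; rewrite /psi_test; case: ifP; rewrite ?lexx ?ler01.
apply: measurable_fun_ifT => //.
by apply: measurable_fun_ltr => //; exact: measurable_t_stat.
Qed.

(** The mean of [t_stat] under the signal [eta]. *)
Let h (e : R) (eta : nat -> R) := \sum_(k < n) w k * (eta k / e) ^+ 2.

(** Since [w k <= 1] one has [w k ^+ 2 <= w k], so the signal part of the variance is at most [8 h];
    the squared weights sum to 1/2, so the pure noise part is at most [C]. Taking [f] general covers
    both the test and its complement. *)
Lemma t_stat_chebyshev (C e D : R) (eta : nat -> R) (f : (nat -> R) -> R) :
  0 <= C -> (\int[N01]_x ((x ^+ 2 - 1) ^+ 2)%R%:E <= C%:E)%E ->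
  0 < e -> 0 < D -> measurable_fun [set: Y] (f : Y -> R) ->
  (forall y, 0 <= f y <= ((t_stat et e y - h e eta) / D) ^+ 2) ->
  E_obs xi e eta f <= (8 * h e eta + C) / D ^+ 2.
Proof.
move=> C0 hC e0 D0 mf fle; rewrite E_obsE.
pose S v := \sum_(k < n) w k * (2 * (eta k / e) * xi k v + (xi k v ^+ 2 - 1)).
have SE v : t_stat et e (observation xi e eta v) - h e eta = S v.
  rewrite t_statE -sumrB; apply: eq_bigr => k _; rewrite -mulrBr; congr (_ * _).
  by rewrite /observation; field; rewrite gt_eqF.
have mS : measurable_fun [set: T] S.
  apply: measurable_sum => k; apply: measurable_funM => //.
  apply: measurable_funD; first exact: measurable_funM.
  by apply: measurable_funB => //; exact: measurable_funX.
apply: (@expectation_le_bound _ _ _ _ _ (fun v => (S v / D) ^+ 2)).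
- by apply: (measurableT_comp mf); exact: measurable_observation.
- by apply: measurable_funX; exact: measurable_funM.
- by move=> v; rewrite -SE.
under eq_integral do rewrite exprMn mulrC EFinM.
rewrite ge0_integralZl//; last 3 first.
- by apply/measurable_EFinP; exact: measurable_funX.
- by move=> v _; rewrite lee_fin sqr_ge0.
- by rewrite lee_fin sqr_ge0.
have -> : ((8 * h e eta + C) / D ^+ 2)%:E = ((D^-1 ^+ 2)%:E * (8 * h e eta + C)%:E)%E.
  by rewrite -EFinM [in RHS]mulrC exprVn.
apply: lee_wpmul2l; first by rewrite lee_fin sqr_ge0.
apply: le_trans (quadratic_second_moment hxi w (fun k => eta k / e) n C0 hC) _.
rewrite lee_fin (eq_bigr (fun k : 'I_n =>
  8 * ((w k) ^+ 2 * (eta k / e) ^+ 2) + 2 * C * (w k) ^+ 2)); last first.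
  by move=> k _; ring.
rewrite big_split/= -!mulr_sumr weights_sqr_sum lerD//; last by rewrite mulrC; lra.
rewrite ler_pM2l// /h; apply: ler_sum => k _.
apply: ler_wpM2r; first exact: sqr_ge0.
by rewrite expr2 ler_piMr// ?weights_ge0// weights_le1.
Qed.

(** Both sides have the denominator [sqrt (2 V) e^2]; the numerators are [V] and the sum in the
    hypothesis. *)
Lemma mean_shift_ge (e : R) (eta : nat -> R) : 0 < e ->
  V <= \sum_(k < n) (et k) ^+ 2 * (eta k) ^+ 2 ->
  Num.sqrt ((2 * e ^+ 4)^-1 * V) <= h e eta.
Proof.
move=> e0 hV.
have s0 : 0 < Num.sqrt (2 * V) by rewrite sqrtr_gt0 mulr_gt0.
have s2 : Num.sqrt (2 * V) ^+ 2 = 2 * V by rewrite sqr_sqrtr// mulr_ge0// ltW.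
have -> : h e eta = (\sum_(k < n) (et k) ^+ 2 * (eta k) ^+ 2) /
    (Num.sqrt (2 * V) * e ^+ 2).
  rewrite mulr_suml; apply: eq_bigr => k _; rewrite /w weightsE.
  by field; rewrite !gt_eqF.
have -> : Num.sqrt ((2 * e ^+ 4)^-1 * V) = V / (Num.sqrt (2 * V) * e ^+ 2).
  have -> : (2 * e ^+ 4)^-1 * V = (V / (Num.sqrt (2 * V) * e ^+ 2)) ^+ 2.
    rewrite expr_div_n exprMn s2; field.
    by rewrite !gt_eqF.
  by rewrite sqrtr_sqr ger0_norm// divr_ge0 ?ltW// mulr_gt0// exprn_gt0.
by rewrite ler_pM2r// invr_gt0 mulr_gt0// exprn_gt0.
Qed.

(** The threshold stays above a multiple of [u] and below the fraction [(1 + c) / 2] of the mean of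
    every alternative, so Chebyshev applies on both sides; [u >= 1] reduces the bounds to order
    [1 / u]. *)
Lemma psi_test_gamma_le (C e c H : R) (Th : set (nat -> R)) :
  0 <= C -> (\int[N01]_x ((x ^+ 2 - 1) ^+ 2)%R%:E <= C%:E)%E ->
  0 < e -> 0 < c < 1 ->
  let u := Num.sqrt ((2 * e ^+ 4)^-1 * V) in
  1 <= u -> c / 2 * u <= H <= (1 + c) / 2 * u ->
  (forall eta, Th eta -> V <= \sum_(k < n) (et k) ^+ 2 * (eta k) ^+ 2) ->
  gamma_err xi e Th (psi_test et e H) <=
    (4 * C / c ^+ 2 + 4 * (8 + C) / (1 - c) ^+ 2) / u.
Proof.
move=> C0 hC e0 /andP[c0 c1] u u1 /andP[H1 H2] hTh.
have u0 : 0 < u by lra.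
have [mpsi psi01] := psi_test_is_test e H.
have cu0 : 0 < c * u by rewrite mulr_gt0.
have H0 : 0 < H by nra.
rewrite /gamma_err mulrDl; apply: lerD.
  rewrite /alpha_err.
  have h0 : h e (fun=> 0) = 0.
    by rewrite /h big1// => k _; rewrite mul0r expr0n/= mulr0.
  apply: (@le_trans _ _ ((8 * h e (fun=> 0) + C) / H ^+ 2)).
    apply: t_stat_chebyshev => // y; rewrite h0 subr0 /psi_test.
    case: ltP => [Ht|_]; last by rewrite lexx sqr_ge0.
    by rewrite ler01/= exprn_ege1// ler_pdivlMr// mul1r ltW.
  rewrite h0 mulr0 add0r.
  have -> : 4 * C / c ^+ 2 / u = C * (4 / (c ^+ 2 * u)) by field; rewrite !gt_eqF.
  apply: ler_wpM2l => //.
  rewrite -[4 / _]invrK lef_pV2 ?posrE ?exprn_gt0 ?invr_gt0 ?divr_gt0 ?mulr_gt0 ?exprn_gt0//.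
  rewrite invf_div ler_pdivrMr//.
  have cu : c * u <= 2 * H by lra.
  have : (c * u) ^+ 2 <= (2 * H) ^+ 2 by rewrite ler_sqr ?nnegrE// ltW// mulr_gt0.
  have : c ^+ 2 * u <= (c * u) ^+ 2.
    by rewrite exprMn ler_pM2l ?exprn_gt0// expr2 ler_peMr// ltW.
  nra.
have M0 : 0 <= 4 * (8 + C) / (1 - c) ^+ 2 / u.
  by rewrite !divr_ge0 ?sqr_ge0 ?(ltW u0)// mulr_ge0// addr_ge0.
apply: beta_err_le => // eta Theta0.
have hu : u <= h e eta by apply: mean_shift_ge => //; exact: hTh.
set g := h e eta in hu *.
have cg : 0 < 1 - c by lra.
(* The gap is proportional to [g], not only to [u]; this beats the term [8 g] of the variance for
   arbitrarily strong signals. *)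
have Dg : (1 - c) / 2 * g <= g - H by nra.
have D0 : 0 < g - H by nra.
apply: (@le_trans _ _ ((8 * g + C) / (g - H) ^+ 2)).
  apply: t_stat_chebyshev => //; first exact: measurable_funB.
  move=> y; rewrite /psi_test -/g; case: ltP => [_|Ht].
    by rewrite subrr lexx sqr_ge0.
  rewrite subr0 ler01/= -sqrrN exprn_ege1// -mulNr ler_pdivlMr// mul1r; lra.
have g0 : 0 < g by lra.
apply: (@le_trans _ _ ((8 * g + C) / ((1 - c) / 2 * g) ^+ 2)).
  apply: ler_wpM2l; first by rewrite addr_ge0// mulr_ge0// ltW.
  rewrite lef_pV2 ?posrE ?exprn_gt0 ?mulr_gt0 ?divr_gt0//.
  by rewrite ler_sqr// nnegrE ltW// mulr_gt0 ?divr_gt0.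
apply: (@le_trans _ _ (4 * (8 + C) / (1 - c) ^+ 2 / g)).
  have -> : (8 * g + C) / ((1 - c) / 2 * g) ^+ 2 =
     4 / (1 - c) ^+ 2 / g * (8 + C / g) by field; rewrite !gt_eqF.
  have -> : 4 * (8 + C) / (1 - c) ^+ 2 / g = 4 / (1 - c) ^+ 2 / g * (8 + C) by field; rewrite !gt_eqF.
  apply: ler_wpM2l; first by rewrite !divr_ge0 ?sqr_ge0// ltW.
  by rewrite lerD2l ler_pdivrMr// ler_peMr//; lra.
apply: ler_wpM2l; last by rewrite lef_pV2 ?posrE.
by rewrite divr_ge0 ?sqr_ge0// mulr_ge0// addr_ge0.
Qed.

End statistic.
End test_errors.

(** * Consistency of the extreme-sequence test *)

Section consistency.
Context d (T : measurableType d) (R : realType) (P : probability T R).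
Variable xi : nat -> {RV P >-> R}.
Hypothesis hxi : iid_std_normal xi.

Lemma alpha_err_itv e psi : is_test psi -> 0 <= alpha_err xi e psi <= 1.
Proof. by move=> [mpsi psi01]; exact: E_obs_unit. Qed.

Lemma gamma_err_ge0 e Th psi : is_test psi -> 0 <= gamma_err xi e Th psi.
Proof.
move=> tpsi; rewrite addr_ge0 ?beta_err_ge0//.
by have /andP[] := alpha_err_itv e tpsi.
Qed.

Lemma extreme_test_consistent (q alpha beta c : R) (r H : R -> R)
    (etat : R -> nat -> R) :
  0 < q -> q <= 2 -> 0 < alpha -> 0 < beta ->
  vanishing_family r ->
  (\forall e \near 0^'+,
    extreme_sequence (pow_seq alpha) (exp_seq beta) (r e) (etat e)) ->
  (u_val (pow_seq alpha) (exp_seq beta) e (r e) @[e --> 0^'+] --> +oo) ->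
  0 < c < 1 ->
  ((H e / (c * u_val (pow_seq alpha) (exp_seq beta) e (r e)) : R)
      @[e --> 0^'+] --> (1 : R)) ->
  gamma_err xi e (Theta_r (pow_seq alpha) (exp_seq beta) q (r e))
    (psi_test (etat e) e (H e)) @[e --> 0^'+] --> (0 : R).
Proof.
move=> q0 q2 al0 be0 [rpos _] hext hu hc hH.
have /andP[c0 c1] := hc.
have [C [C0 hC]] := @normal_fourth_moment_fin R.
set u := fun e => u_val (pow_seq alpha) (exp_seq beta) e (r e) in hu hH *.
pose M := 4 * C / c ^+ 2 + 4 * (8 + C) / (1 - c) ^+ 2.
apply: (@squeeze_cvgr _ _ _ _ (fun=> 0) (fun e => M / u e)).
- near=> e.
  have e0 : 0 < e by near: e; exact: nbhs_right_gt.
  have re0 : 0 < r e by near: e.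
  have ext : extreme_sequence (pow_seq alpha) (exp_seq beta) (r e) (etat e).
    by near: e.
  have u1 : 1 <= u e by near: e; move/cvgryPge : hu; exact.
  have Hl : 2^-1 <= H e / (c * u e).
    near: e; apply: (cvgr_ge (1 : R)) => //; lra.
  (* This bound exceeds the limit 1 because [c < 1]; multiplied by [c u] it is the upper end
     [(1 + c) / 2 * u] of the threshold window. *)
  have Hu : H e / (c * u e) <= (1 + c) / (2 * c).
    near: e; apply: (cvgr_le (1 : R)) => //.
    by rewrite ltr_pdivlMr ?mulr_gt0//; lra.
  have [z0 [A [n [A0 an etE sums sumas]]]] := extreme_sequence_cutoff al0 be0 re0 ext.
  have et_tail := extreme_tail an etE.
  have uE : u e = Num.sqrt ((2 * e ^+ 4)^-1 * \sum_(k < n) (etat e k) ^+ 4).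
    exact: (u_val_extreme A0 an etE sums sumas).
  have V0 : 0 < \sum_(k < n) (etat e k) ^+ 4.
    rewrite lt_neqAle sumr_ge0 ?andbT; last by move=> k _; rewrite exprn_even_ge0.
    by apply/eqP => V0; move: u1; rewrite uE -V0 mulr0 sqrtr0 ler10.
  have cu : 0 < c * u e by rewrite mulr_gt0//; lra.
  apply/andP; split.
    by apply: gamma_err_ge0; exact: (psi_test_is_test et_tail).
  rewrite /M uE; apply: (psi_test_gamma_le hxi et_tail) => //.
  - by rewrite -uE.
  - rewrite -uE; apply/andP; split.
      by move: Hl; rewrite ler_pdivlMr//; lra.
    move: Hu; rewrite ler_pdivrMr//.
    have -> : (1 + c) / (2 * c) * (c * u e) = (1 + c) / 2 * u e by field; rewrite gt_eqF.
    by [].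
  - move=> eta /(Theta_r_sub q0 q2); exact: (extreme_min A0 an etE sums sumas).
- exact: cvg_cst.
- rewrite -[X in _ --> X](mulr0 M); apply: cvgMr.
  apply/gtr0_cvgV0 => //; near=> e.
  by apply: (@lt_le_trans _ _ 1) => //; near: e; move/cvgryPge : hu; exact.
Unshelve. all: by end_near. Qed.

End consistency.

(** * The separation rate *)

Section rate_scale.
Context (R : realType).
Variables alpha beta : R.
Hypotheses (al0 : 0 < alpha) (be0 : 0 < beta).

Let K (e : R) := ln e^-1 / beta.

Lemma expR_log_scale (e : R) : 0 < e -> expR (beta * K e) = e^-1.
Proof.
by move=> e0; rewrite /K mulrCA divff ?gt_eqF// mulr1 lnK// posrE invr_gt0.
Qed.

Lemma log_scale_cvgy : K e @[e --> 0^'+] --> +oo.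
Proof.
apply/cvgryPge => A; near=> e.
have e0 : 0 < e by near: e; exact: nbhs_right_gt.
have eA : e < expR (- (beta * A)) by near: e; apply: nbhs_right_lt; exact: expR_gt0.
rewrite /K ler_pdivlMr// lnV ?posrE// mulrC lerNr.
by rewrite -[leRHS]expRK ler_ln ?posrE ?expR_gt0// ltW.
Unshelve. all: by end_near. Qed.

Lemma div_log_scale_cvg0 (D : R) : D / K e @[e --> 0^'+] --> (0 : R).
Proof.
rewrite -[X in _ --> X](mulr0 D); apply: cvgMr.
apply/gtr0_cvgV0; last exact: log_scale_cvgy.
near=> e; apply: (@lt_le_trans _ _ 1) => //; near: e.
by move/cvgryPge : log_scale_cvgy; exact.
Unshelve. all: by end_near. Qed.

Lemma vanishing_log_rate : vanishing_family (fun e => K e `^ (- alpha)).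
Proof.
have K1 : \forall e \near 0^'+, 1 <= K e.
  by move/cvgryPge : log_scale_cvgy; exact.
split.
  near=> e; rewrite powR_gt0//; apply: (@lt_le_trans _ _ 1) => //.
  by near: e.
under eq_fun do rewrite powRN.
apply/gtr0_cvgV0.
  near=> e; rewrite powR_gt0//; apply: (@lt_le_trans _ _ 1) => //.
  by near: e.
apply/cvgryPge => A; near=> e.
have h : `|A| `^ alpha^-1 <= K e.
  by near: e; move/cvgryPge : log_scale_cvgy; exact.
apply: (le_trans (ler_norm A)).
rewrite -[leLHS]powRr1// -(mulVf (lt0r_neq0 al0)) powRrM.
apply: ge0_ler_powR; rewrite ?nnegrE ?powR_ge0//; first exact: ltW.
exact: le_trans h.
Unshelve. all: by end_near. Qed.

(** From [x <= c exp (x / c)] raised to the power [p + 1]: the choice [c = (p + 1) / beta] makes the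
    exponential equal to [exp (beta K) = 1/e]. *)
Lemma powR_log_scale_le (p e : R) : 0 < p -> 0 < e -> 0 < K e ->
  e * K e `^ p <= ((p + 1) / beta) `^ (p + 1) / K e.
Proof.
move=> p0 e0 K0; set c := (p + 1) / beta.
have p10 : 0 < p + 1 by lra.
have c0 : 0 < c by rewrite divr_gt0.
rewrite ler_pdivlMr// -mulrA.
have -> : K e `^ p * K e = K e `^ (p + 1).
  rewrite powRD; first by rewrite powRr1// ltW.
  by rewrite lt0r_neq0 ?implybT.
rewrite mulrC -ler_pdivlMr// -(expR_log_scale e0).
have Kc : K e <= c * expR (K e / c).
  by rewrite mulrC -ler_pdivrMr//; have := expR_ge1Dx (K e / c); lra.
apply: (@le_trans _ _ ((c * expR (K e / c)) `^ (p + 1))).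
  apply: ge0_ler_powR; rewrite ?nnegrE//; [exact: ltW|exact: ltW|].
  by rewrite mulr_ge0 ?expR_ge0// ltW.
rewrite powRM ?expR_ge0 ?(ltW c0)// -expRM le_eqVlt; apply/orP; left; apply/eqP.
by congr (_ * expR _); rewrite /c; field; rewrite !gt_eqF.
Qed.

End rate_scale.

(** * Minimax errors and the energy test *)

Section separation.
Context d (T : measurableType d) (R : realType) (P : probability T R).
Variable xi : nat -> {RV P >-> R}.
Hypothesis hxi : iid_std_normal xi.
Local Notation Y := (g_sigma_algebraType (@cylinders R)).

Lemma is_test_cst (c : R) : 0 <= c <= 1 -> is_test (fun=> c).
Proof. by move=> c01; split. Qed.

Lemma E_obs_cst e eta (c : R) : E_obs xi e eta (fun=> c) = c.
Proof.
rewrite E_obsE -[X in fine X]/(\int[P]_w cst c%:E w)%E integral_cst//.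
by rewrite [X in (_ * X)%E]probability_setT mule1.
Qed.

Lemma minimax_gamma_le e Th psi : is_test psi ->
  minimax_gamma xi e Th <= gamma_err xi e Th psi.
Proof.
move=> tpsi; apply: ge_inf; last by exists psi.
by exists 0 => _ [p tp <-]; exact: gamma_err_ge0.
Qed.

Lemma minimax_gamma_ge e Th b :
  (forall psi, is_test psi -> b <= gamma_err xi e Th psi) ->
  b <= minimax_gamma xi e Th.
Proof.
move=> h; apply: lb_le_inf => [|_ [psi tpsi <-]]; last exact: h.
exists (gamma_err xi e Th (fun=> 0)), (fun=> 0) => //.
by apply: is_test_cst; rewrite lexx ler01.
Qed.

Lemma minimax_gamma_le1 e Th : minimax_gamma xi e Th <= 1.
Proof.
have t0 : is_test (fun=> 0 : R) by apply: is_test_cst; rewrite lexx ler01.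
apply: le_trans (minimax_gamma_le e Th t0) _.
rewrite /gamma_err /alpha_err E_obs_cst add0r; apply: beta_err_le => // eta _.
by rewrite subr0 E_obs_cst.
Qed.

Lemma minimax_beta_le e Th theta psi : is_test psi -> alpha_err xi e psi <= theta ->
  minimax_beta xi e Th theta <= beta_err xi e Th psi.
Proof.
move=> tpsi hpsi; apply: ge_inf; last by exists psi.
by exists 0 => _ [p [tp _] <-]; exact: beta_err_ge0.
Qed.

Lemma minimax_beta_ge e Th theta b : 0 <= theta ->
  (forall psi, is_test psi -> alpha_err xi e psi <= theta ->
     b <= beta_err xi e Th psi) ->
  b <= minimax_beta xi e Th theta.
Proof.
move=> th0 h; apply: lb_le_inf => [|_ [psi [tpsi hpsi] <-]]; last exact: h.
exists (beta_err xi e Th (fun=> 0)), (fun=> 0) => //; split.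
  by apply: is_test_cst; rewrite lexx ler01.
by rewrite /alpha_err E_obs_cst.
Qed.

Lemma minimax_beta_le_onem e Th theta : 0 <= theta <= 1 ->
  minimax_beta xi e Th theta <= 1 - theta.
Proof.
move=> /andP[th0 th1].
apply: (le_trans (@minimax_beta_le e Th theta (fun=> theta) _ _)).
- by apply: is_test_cst; rewrite th0.
- by rewrite /alpha_err E_obs_cst.
apply: beta_err_le; first by rewrite subr_ge0.
by move=> eta _; rewrite E_obs_cst.
Qed.

Lemma beta_err_single_coord e Th psi eta j t : is_test psi -> Th eta ->
  0 < t <= 2^-1 -> eta j = e * t -> (forall i, i != j -> eta i = 0) ->
  1 - alpha_err xi e psi - 2 * t <= beta_err xi e Th psi.
Proof.
move=> tpsi Theta0 t01 etaj etai; have [mpsi psi01] := tpsi.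
apply: le_trans (beta_err_ge _ e tpsi Theta0).
have m1 : measurable_fun [set: Y] ((fun y => 1 - psi y) : Y -> R).
  exact: measurable_funB.
have b1 y : 0 <= 1 - psi y <= 1 by have := psi01 y; lra.
rewrite lerBlDr /alpha_err -E_obs_onem//.
exact: (E_obs_single_coord hxi m1 b1 t01 etaj etai).
Qed.

Definition energy_test (m : nat) (e H : R) (y : nat -> R) : R :=
  if H < \sum_(k < m) (y k / e) ^+ 2 then 1 else 0.

Lemma energy_test_is_test m e H : is_test (energy_test m e H).
Proof.
split; last by move=> y; rewrite /energy_test; case: ifP; rewrite ?lexx ?ler01.
apply: measurable_fun_ifT => //; apply: measurable_fun_ltr => //.
apply: measurable_sum => k; apply: measurable_funX; apply: measurable_funM => //.
exact: measurable_coord.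
Qed.

Let noise_energy_le (m : nat) (e H : R) (eta : nat -> R) (f : (nat -> R) -> R) :
  0 < H -> measurable_fun [set: Y] (f : Y -> R) ->
  (forall w, 0 <= f (observation xi e eta w) <= H^-1 * \sum_(k < m) (xi k w) ^+ 2) ->
  E_obs xi e eta f <= m%:R / H.
Proof.
move=> H0 mf hf; rewrite E_obsE.
apply: (@expectation_le_bound _ _ _ _ _ (fun w => H^-1 * \sum_(k < m) (xi k w) ^+ 2)) => //.
- by apply: (measurableT_comp mf); exact: measurable_observation.
- by apply: measurable_funM => //; apply: measurable_sum => k; exact: measurable_funX.
under eq_integral do rewrite EFinM.
rewrite ge0_integralZl//; last 3 first.
- by apply/measurable_EFinP; apply: measurable_sum => k; exact: measurable_funX.
- by move=> w _; rewrite lee_fin sumr_ge0// => k _; exact: sqr_ge0.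
- by rewrite lee_fin invr_ge0 ltW.
by rewrite (integral_noise_sum_sqr hxi) -EFinM mulrC.
Qed.

Lemma energy_test_alpha m e H : 0 < e -> 0 < H ->
  alpha_err xi e (energy_test m e H) <= m%:R / H.
Proof.
move=> e0 H0; apply: noise_energy_le => //; first by have [] := energy_test_is_test m e H.
move=> w; rewrite /energy_test.
have -> : \sum_(k < m) (observation xi e (fun=> 0) w k / e) ^+ 2 =
    \sum_(k < m) (xi k w) ^+ 2.
  apply: eq_bigr => k _; congr (_ ^+ 2).
  by rewrite /observation add0r mulrAC divff ?mul1r// gt_eqF.
case: ltP => [h|_]; last first.
  by rewrite lexx mulr_ge0 ?invr_ge0 ?(ltW H0)// sumr_ge0// => k _; exact: sqr_ge0.
by rewrite ler01 mulrC ler_pdivlMr// mul1r ltW.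
Qed.

(** If the test accepts, the observed energy is at most [H] while the signal energy is at least
    [4 H]; the noise energy must then be at least [H], and Markov applies. *)
Lemma energy_test_beta m e H (Th : set (nat -> R)) : 0 < e -> 0 < H ->
  (forall eta, Th eta -> 4 * H <= \sum_(k < m) (eta k / e) ^+ 2) ->
  beta_err xi e Th (energy_test m e H) <= m%:R / H.
Proof.
move=> e0 H0 hTh; apply: beta_err_le => [|eta Theta0].
  by rewrite divr_ge0// ltW.
have [mt _] := energy_test_is_test m e H.
apply: noise_energy_le => //; first exact: measurable_funB.
move=> w; rewrite /energy_test; case: ltP => [_|h].
  rewrite subrr lexx mulr_ge0 ?invr_ge0 ?(ltW H0)// sumr_ge0// => k _.
  exact: sqr_ge0.
rewrite subr0 ler01 mulrC ler_pdivlMr// mul1r.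
have := hTh _ Theta0.
have : \sum_(k < m) (eta k / e) ^+ 2 <=
    2 * \sum_(k < m) (observation xi e eta w k / e) ^+ 2 +
    2 * \sum_(k < m) (xi k w) ^+ 2.
  rewrite !mulr_sumr -big_split/=; apply: ler_sum => k _.
  have -> : observation xi e eta w k / e = eta k / e + xi k w.
    by rewrite /observation; field; rewrite gt_eqF.
  (* [2 (x + z)^2 + 2 z^2 - x^2] is exactly [(x + 2 z)^2]. *)
  by have := sqr_ge0 (eta k / e + 2 * xi k w); nra.
lra.
Qed.

End separation.

(** * Alternatives for polynomial [a] and exponential [s] *)

Section rate_sequences.
Context (R : realType).
Variables alpha beta : R.
Hypotheses (al0 : 0 < alpha) (be0 : 0 < beta).
Local Notation a := (pow_seq alpha).
Local Notation s := (exp_seq beta).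

Lemma nnseries_single (f : nat -> R) (j : nat) : (forall k, 0 <= f k) ->
  (forall k, k != j -> f k = 0) -> (\sum_(k <oo) (f k)%:E = (f j)%:E)%E.
Proof.
move=> f0 fj; rewrite (@nnseries_finite _ _ j.+1)//.
  rewrite big_ord_recr/= big1 ?add0r// => i _.
  by rewrite fj// ltn_eqF.
by move=> k jk; rewrite fj// gtn_eqF.
Qed.

(** The height makes the only nonzero term [a_j s_j eta_j] equal to 1, whose powers are all 1; the
    weighted energy is then [a_j^-2]. *)
Definition spike (j k : nat) : R := if k == j then (a j * s j)^-1 else 0.

Lemma pow_seq_gt0 k : 0 < a k.
Proof. by rewrite /pow_seq powR_gt0. Qed.

Lemma exp_seq_gt0 k : 0 < s k.
Proof. exact: expR_gt0. Qed.

Lemma spike_in (q r : R) (j : nat) : 0 < q -> 0 <= r -> r <= (a j)^-1 ->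
  Theta_r a s q r (spike j).
Proof.
move=> q0 r0 ra.
have aj := pow_seq_gt0 j; have sj := exp_seq_gt0 j.
have sp0 k : k != j -> spike j k = 0 by rewrite /spike => /negbTE ->.
have spj : spike j j = (a j * s j)^-1 by rewrite /spike eqxx.
split; [split|].
- rewrite /l2/= (@nnseries_single (fun k => spike j k ^+ 2) j) ?ltry//.
  + by move=> k; rewrite sqr_ge0.
  + by move=> k /sp0 ->; rewrite expr0n.
- rewrite (@nnseries_single (fun k => `|a k * s k * spike j k| `^ q) j).
  + by rewrite spj divff ?normr1 ?powR1// gt_eqF// mulr_gt0.
  + by move=> k; exact: powR_ge0.
  + by move=> k /sp0 ->; rewrite mulr0 normr0 powR0// gt_eqF.
- rewrite (@nnseries_single (fun k => s k ^+ 2 * spike j k ^+ 2) j).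
  + rewrite spj -exprMn invfM mulrCA divff ?gt_eqF// mulr1 lee_fin.
    by rewrite ler_sqr// nnegrE invr_ge0 ltW.
  + by move=> k; rewrite mulr_ge0 ?sqr_ge0.
  + by move=> k /sp0 ->; rewrite expr0n mulr0.
Qed.

(* Beyond index [m] the ellipsoid constraint caps the energy at
   [a_m^-2 <= r^2 / 2], so half of [r^2] sits in the first [m] coordinates. *)
Lemma Theta_r_head_energy (r : R) (m : nat) (eta : nat -> R) :
  2 <= r ^+ 2 * (a m) ^+ 2 -> Theta_r a s 2 r eta ->
  r ^+ 2 / 2 <= \sum_(k < m) (s k) ^+ 2 * (eta k) ^+ 2.
Proof.
move=> ram [th hr].
have am0 := pow_seq_gt0 m.
pose F k := s k ^+ 2 * eta k ^+ 2.
have F0 k : 0 <= F k by rewrite mulr_ge0 ?sqr_ge0.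
suff : r ^+ 2 <= \sum_(k < m) F k + (a m) ^- 2.
  have : (a m) ^- 2 <= r ^+ 2 / 2.
    by rewrite -[leLHS]mul1r ler_pdivrMr ?exprn_gt0//; lra.
  by rewrite /F; lra.
rewrite -lee_fin; apply: le_trans hr _.
apply: (@nnseries_le_bound _ F _ m) => // N mN.
rewrite -!(big_mkord xpredT F) (big_cat_nat (leq0n m) mN)/= lerD2l.
rewrite -[leRHS]mul1r ler_pdivlMr ?exprn_gt0//.
apply: le_trans (Theta2_sum N th).
rewrite -(big_mkord xpredT (fun k => a k ^+ 2 * s k ^+ 2 * eta k ^+ 2)).
rewrite (big_cat_nat (leq0n m) mN)/= mulr_suml.
rewrite -[leLHS]add0r lerD//.
  by apply: sumr_ge0 => k _; rewrite mulr_ge0 ?sqr_ge0// mulr_ge0 ?sqr_ge0.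
rewrite !big_nat; apply: ler_sum => k /andP[mk _].
rewrite mulrC -mulrA; apply: ler_wpM2r; first exact: F0.
rewrite ler_sqr ?nnegrE ?(ltW (pow_seq_gt0 _))//.
by apply: ge0_ler_powR; rewrite ?nnegrE ?ler0n ?ler_nat// ltW.
Qed.

Lemma Theta_r_head_signal (r e : R) (m : nat) (eta : nat -> R) : 0 < e ->
  2 <= r ^+ 2 * (a m) ^+ 2 -> Theta_r a s 2 r eta ->
  expR (beta * m%:R) ^- 2 * r ^+ 2 / (2 * e ^+ 2) <=
  \sum_(k < m) (eta k / e) ^+ 2.
Proof.
move=> e0 ram th; have E0 := expR_gt0 (beta * m%:R).
have h := Theta_r_head_energy ram th.
have h2 : \sum_(k < m) (s k) ^+ 2 * (eta k) ^+ 2 <=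
    expR (beta * m%:R) ^+ 2 * (e ^+ 2 * \sum_(k < m) (eta k / e) ^+ 2).
  rewrite !mulr_sumr; apply: ler_sum => k _.
  have -> : e ^+ 2 * (eta k / e) ^+ 2 = eta k ^+ 2 by field; rewrite gt_eqF.
  apply: ler_wpM2r; first exact: sqr_ge0.
  (* Positions [k < m] carry indices [k + 1 <= m], hence the amplification [exp (beta m)]. *)
  rewrite ler_sqr ?nnegrE ?expR_ge0// ler_expR ler_pM2l// ler_nat.
  exact: ltn_ord.
have := le_trans h h2.
set S := \sum_(k < m) _ => hh.
rewrite ler_pdivrMr ?mulr_gt0 ?exprn_gt0// mulrC ler_pdivrMr ?exprn_gt0//.
by rewrite -[leLHS](@divfK _ 2)//; nra.
Qed.

End rate_sequences.

Lemma powR_ge1 (R : realType) (x p : R) : 1 <= x -> 0 <= p -> 1 <= x `^ p.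
Proof. by move=> x1 p0; rewrite -(powRr0 x); exact: ler_powR. Qed.

(** * Lower and upper bounds around the rate *)

Section separation_rate.
Context d (T : measurableType d) (R : realType) (P : probability T R).
Variable xi : nat -> {RV P >-> R}.
Hypothesis hxi : iid_std_normal xi.
Variables q alpha beta : R.
Hypotheses (q0 : 0 < q) (q2 : q <= 2) (al0 : 0 < alpha) (be0 : 0 < beta).
Local Notation Th := (Theta_r (pow_seq alpha) (exp_seq beta) q).
Local Notation K e := (ln e^-1 / beta).

Lemma beta_err_lower (e r : R) (psi : (nat -> R) -> R) :
  0 < e <= 2^-1 -> 1 <= K e -> 0 < r -> r / K e `^ (- alpha) <= (3 `^ alpha)^-1 ->
  is_test psi -> 1 - alpha_err xi e psi - 2 * e <= beta_err xi e (Th r) psi.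
Proof.
move=> /andP[e0 e2] K1 r0 hr tpsi.
have K0 : 0 < K e by lra.
pose j := Num.trunc (2 * K e).
have K20 : 0 <= 2 * K e by lra.
have /andP[jl ju] := truncn_itv K20; rewrite -/j in jl ju.
have aj := pow_seq_gt0 alpha j; have sj := exp_seq_gt0 beta j.
have Ka : 0 < K e `^ alpha by rewrite powR_gt0.
have ra : r <= (pow_seq alpha j)^-1.
  move: hr; rewrite powRN invrK -ler_pdivlMr// -invfM => /le_trans; apply.
  rewrite lef_pV2 ?posrE ?mulr_gt0 ?powR_gt0// -powRM ?(ltW K0)//.
  have jK : j.+1%:R <= 3 * K e by move: jl ju; rewrite -natr1; lra.
  apply: ge0_ler_powR => //; [exact: ltW|by rewrite nnegrE|].
  by rewrite nnegrE; lra.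
have t0 : 0 < spike alpha beta j j / e.
  by rewrite /spike eqxx divr_gt0// invr_gt0 mulr_gt0.
have te : spike alpha beta j j / e <= e.
  rewrite /spike eqxx ler_pdivrMr// -[leLHS]mul1r ler_pdivrMr ?mulr_gt0//.
  have a1 : 1 <= pow_seq alpha j.
    by apply: powR_ge1; [rewrite ler1n|exact: ltW].
  have s1 : e^-1 * e^-1 <= exp_seq beta j.
    rewrite -(expR_log_scale be0 e0) -expRD ler_expR -mulrDr ler_pM2l//; lra.
  have ee : e * e * (e^-1 * e^-1) = 1 by field; rewrite gt_eqF.
  rewrite -ee ler_pM2l ?mulr_gt0//; apply: le_trans s1 _.
  by rewrite ler_peMl// ltW.
have Theta0 : Th r (spike alpha beta j) by apply: spike_in => //; exact: ltW.
apply: (@le_trans _ _ (1 - alpha_err xi e psi - 2 * (spike alpha beta j j / e))); first by lra.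
apply: (beta_err_single_coord hxi tpsi Theta0) (_ : _ = e * (_ / e)) _.
- by rewrite t0; apply: le_trans te _.
- by rewrite mulrC divfK// gt_eqF.
- by move=> i; rewrite /spike => /negbTE ->.
Qed.

Lemma energy_test_errors (e r : R) :
  0 < e -> 1 <= K e -> 0 < r -> 2 * 2 `^ alpha <= r / K e `^ (- alpha) ->
  exists psi, [/\ is_test psi,
    alpha_err xi e psi <= 4 * ((2 * alpha + 1 + 1) / beta) `^ (2 * alpha + 1 + 1) / K e &
    beta_err xi e (Th r) psi <= 4 * ((2 * alpha + 1 + 1) / beta) `^ (2 * alpha + 1 + 1) / K e].
Proof.
move=> e0 K1 r0 hr.
have K0 : 0 < K e by lra.
pose m := Num.trunc (K e / 2).
have K20 : 0 <= K e / 2 by lra.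
have /andP[ml mu] := truncn_itv K20; rewrite -/m in ml mu.
set k := K e `^ alpha.
have k0 : 0 < k by rewrite powR_gt0.
pose H := (8 * e * k ^+ 2)^-1.
have H0 : 0 < H by rewrite invr_gt0 !mulr_gt0// exprn_gt0.
have p2 : 0 < 2 `^ alpha :> R by rewrite powR_gt0.
have rk : 2 * 2 `^ alpha <= r * k by move: hr; rewrite powRN invrK.
have p1 : 1 <= 2 `^ alpha :> R.
  by apply: powR_ge1; [rewrite ler1n|exact: ltW].
have am : k <= 2 `^ alpha * pow_seq alpha m.
  rewrite /k /pow_seq -powRM//; apply: ge0_ler_powR; rewrite ?nnegrE.
  - exact: ltW.
  - exact: ltW.
  - by [].
  - lra.
have ram : 2 <= r ^+ 2 * (pow_seq alpha m) ^+ 2.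
  have am0 := pow_seq_gt0 alpha m.
  have : 2 <= r * pow_seq alpha m.
    rewrite -(ler_pM2l p2) mulrC mulrCA; apply: le_trans rk _.
    by rewrite ler_pM2l.
  by rewrite -exprMn; move: (r * _) => x hx; nra.
have mH : m%:R / H <= 4 * ((2 * alpha + 1 + 1) / beta) `^ (2 * alpha + 1 + 1) / K e.
  rewrite /H invrK.
  have p0 : 0 < 2 * alpha + 1 by rewrite addr_gt0 ?mulr_gt0.
  have := powR_log_scale_le be0 p0 e0 K0.
  have -> : K e `^ (2 * alpha + 1) = k ^+ 2 * K e.
    rewrite powRD; last by apply/implyP => _; rewrite gt_eqF.
    by rewrite powRr1 ?(ltW K0)// [2 * alpha]mulrC powRrM powR_mulrn ?powR_ge0.
  rewrite -[X in _ -> _ <= X]mulrA; set D := _ / K e; move=> h.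
  apply: (@le_trans _ _ (4 * (e * (k ^+ 2 * K e)))); last by rewrite ler_pM2l.
  have -> : m%:R * (8 * e * k ^+ 2) = m%:R * 2 * (4 * (e * k ^+ 2)) by ring.
  have -> : 4 * (e * (k ^+ 2 * K e)) = K e * (4 * (e * k ^+ 2)) by ring.
  rewrite ler_pM2r ?mulr_gt0 ?exprn_gt0//; lra.
exists (energy_test m e H); split; first exact: energy_test_is_test.
  by apply: le_trans mH; apply: energy_test_alpha.
apply: le_trans mH; apply: energy_test_beta => // eta /(Theta_r_sub q0 q2) heta.
apply: le_trans (Theta_r_head_signal al0 be0 e0 ram heta).
have E0 := expR_gt0 (beta * m%:R).
have Ee : expR (beta * m%:R) ^+ 2 * e <= 1.
  rewrite -ler_pdivlMr// mul1r -(expR_log_scale be0 e0) expr2 -expRD ler_expR.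
  by rewrite -mulrDr ler_pM2l//; lra.
have rk1 : 1 <= (r * k) ^+ 2 by rewrite exprn_ege1//; lra.
have -> : 4 * H = 1 / (2 * e * k ^+ 2) by rewrite /H; field; rewrite !gt_eqF.
rewrite ler_pdivrMr ?mulr_gt0 ?exprn_gt0//.
have -> : expR (beta * m%:R) ^- 2 * r ^+ 2 / (2 * e ^+ 2) * (2 * e * k ^+ 2) =
  (r * k) ^+ 2 / (expR (beta * m%:R) ^+ 2 * e) by field; rewrite !gt_eqF.
rewrite ler_pdivlMr ?mulr_gt0 ?exprn_gt0// mul1r; lra.
Qed.

End separation_rate.

Lemma separation_rate_log d (T : measurableType d) (R : realType)
    (P : probability T R) (xi : nat -> {RV P >-> R}) (hxi : iid_std_normal xi)
    (q alpha beta : R) : 0 < q -> q <= 2 -> 0 < alpha -> 0 < beta ->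
  separation_rate xi (Theta_r (pow_seq alpha) (exp_seq beta) q)
    (fun e => (ln e^-1 / beta) `^ (- alpha)).
Proof.
move=> q0 q2 al0 be0; split; first exact: vanishing_log_rate.
move=> r [rpos _].
have K1 : \forall e \near 0^'+, 1 <= ln e^-1 / beta.
  by move/cvgryPge : (log_scale_cvgy be0); exact.
pose D := 4 * ((2 * alpha + 1 + 1) / beta) `^ (2 * alpha + 1 + 1).
have D0 := div_log_scale_cvg0 be0 D.
have D20 := div_log_scale_cvg0 be0 (2 * D).
have e20 (x : R) : x - 2 * e @[e --> 0^'+] --> x.
  rewrite -[X in _ --> X]subr0 -[X in _ - X](mulr0 2).
  apply: cvgB; first exact: cvg_cst.
  apply: cvgMr; exact: cvg_at_right_filter cvg_id.
have low : (r e / (ln e^-1 / beta) `^ (- alpha) @[e --> 0^'+] --> (0 : R)) ->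
    \forall e \near 0^'+, forall psi, is_test psi ->
    1 - alpha_err xi e psi - 2 * e <=
    beta_err xi e (Theta_r (pow_seq alpha) (exp_seq beta) q (r e)) psi.
  move=> hr; near=> e => psi tpsi; apply: (beta_err_lower hxi) => //.
  - apply/andP; split; first by near: e; exact: nbhs_right_gt.
    by near: e; apply: nbhs_right_le; rewrite invr_gt0.
  - by near: e.
  - by near: e.
  - by near: e; apply: (cvgr_le (0 : R)) => //; rewrite invr_gt0 powR_gt0.
split=> hr; split.
- apply: (@squeeze_cvgr _ _ _ _ (fun e => 1 - 2 * e) (fun=> 1)) => //; last exact: cvg_cst.
  near=> e.
  rewrite minimax_gamma_le1 andbT; apply: minimax_gamma_ge => psi tpsi.
  have : forall psi, is_test psi -> 1 - alpha_err xi e psi - 2 * e <=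
    beta_err xi e (Theta_r (pow_seq alpha) (exp_seq beta) q (r e)) psi by near: e; exact: low.
  by move=> /(_ _ tpsi); rewrite /gamma_err; lra.
- move=> theta /andP[th0 th1].
  apply: (@squeeze_cvgr _ _ _ _ (fun e => (1 - theta) - 2 * e) (fun=> 1 - theta)) => //; last exact: cvg_cst.
  near=> e.
  rewrite minimax_beta_le_onem ?andbT ?(ltW th0) ?(ltW th1)//.
  apply: minimax_beta_ge => [|psi tpsi hpsi]; first exact: ltW.
  have : forall psi, is_test psi -> 1 - alpha_err xi e psi - 2 * e <=
    beta_err xi e (Theta_r (pow_seq alpha) (exp_seq beta) q (r e)) psi by near: e; exact: low.
  by move=> /(_ _ tpsi); lra.
- apply: (@squeeze_cvgr _ _ _ _ (fun=> 0) (fun e => 2 * D / (ln e^-1 / beta))) => //; last exact: cvg_cst.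
  near=> e; apply/andP; split.
    by apply: minimax_gamma_ge => psi tpsi; exact: gamma_err_ge0.
  have [psi [tpsi ha hb]] : exists psi, [/\ is_test psi,
    alpha_err xi e psi <= D / (ln e^-1 / beta) &
    beta_err xi e (Theta_r (pow_seq alpha) (exp_seq beta) q (r e)) psi <=
      D / (ln e^-1 / beta)].
    apply: (energy_test_errors hxi) => //.
    - by near: e.
    - by near: e.
    - by near: e; move/cvgryPge : hr; exact.
  apply: le_trans (minimax_gamma_le _ e _ tpsi) _.
  by rewrite /gamma_err -mulrA; lra.
- move=> theta /andP[th0 th1].
  apply: (@squeeze_cvgr _ _ _ _ (fun=> 0) (fun e => D / (ln e^-1 / beta))) => //; last exact: cvg_cst.
  near=> e; apply/andP; split.
    apply: minimax_beta_ge => [|psi tpsi _]; first exact: ltW.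
    exact: beta_err_ge0.
  have [psi [tpsi ha hb]] : exists psi, [/\ is_test psi,
    alpha_err xi e psi <= D / (ln e^-1 / beta) &
    beta_err xi e (Theta_r (pow_seq alpha) (exp_seq beta) q (r e)) psi <=
      D / (ln e^-1 / beta)].
    apply: (energy_test_errors hxi) => //.
    - by near: e.
    - by near: e.
    - by near: e; move/cvgryPge : hr; exact.
  have hth : D / (ln e^-1 / beta) <= theta by near: e; exact: cvgr_le D0 _ th0.
  apply: (le_trans _ hb); apply: minimax_beta_le tpsi _; exact: le_trans ha hth.
Unshelve. all: by end_near. Qed.

Theorem theorem4p4 (d : measure_display) (T : measurableType d) (R : realType)
    (P : probability T R) (xi : nat -> {RV P >-> R}) (hxi : iid_std_normal xi)
    (q alpha beta : R) (hq0 : 0 < q) (hq2 : q <= 2)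
    (halpha : 0 < alpha) (hbeta : 0 < beta) :
  (forall (r : R -> R) (etat : R -> nat -> R) (c : R) (H : R -> R),
     vanishing_family r ->
     (\forall e \near 0^'+,
        extreme_sequence (pow_seq alpha) (exp_seq beta) (r e) (etat e)) ->
     (u_val (pow_seq alpha) (exp_seq beta) e (r e) @[e --> 0^'+] --> +oo) ->
     0 < c < 1 ->
     ((H e / (c * u_val (pow_seq alpha) (exp_seq beta) e (r e)) : R)
        @[e --> 0^'+] --> (1 : R)) ->
     gamma_err xi e (Theta_r (pow_seq alpha) (exp_seq beta) q (r e))
       (psi_test (etat e) e (H e)) @[e --> 0^'+] --> (0 : R))
  /\
  separation_rate xi (Theta_r (pow_seq alpha) (exp_seq beta) q)
    (fun e => (ln e^-1 / beta) `^ (- alpha)).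
Proof.
split; last exact: separation_rate_log.
by move=> r etat c H hr hext hu hc hH; exact: (extreme_test_consistent hxi hq0 hq2 halpha hbeta hr hext hu hc hH).
Qed.
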